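(* As $n\to\infty$, \[ \frac{D_n-\mu\log n}{\sqrt{\log n}}\ \xrightarrow{d}\ \mathrm{Normal}(0,\sigma^2),\qquad \mu=\frac1{\zeta(2)}=\frac{6}{\pi^2},\quad \sigma^2=\frac{2\zeta(3)}{\zeta(2)^3}. \]
   Context: $D_n$ is the absorption time at state 1 of the continuous-time Markov chain on $\{1,2,\dots\}$ started at $n$ that jumps from $m$ to $i$ at rate $1/(m-i)$ for $1\le i\le m-1$ (equivalently, the height of a uniformly random leaf in the continuous-time critical beta-splitting tree). $\zeta$ is the Riemann zeta function. *)

(* Defs.v *)
From HB Require Import structures.
From mathcomp Require Import all_boot all_order all_algebra.
From mathcomp Require Import all_classical all_reals all_analysis.
Set Implicit Arguments. Unset Strict Implicit. Unset Printing Implicit Defensive.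
Import Order.TTheory GRing.Theory Num.Theory.
Import numFieldNormedType.Exports.
Local Open Scope classical_set_scope.
Local Open Scope ring_scope.

Section Defs.
Variable R : realType.

Definition zeta (s : nat) : R :=
  limn (fun N : nat => \sum_(1 <= k < N) ((k%:R : R) ^- s)).

(* Jump rate of the chain from state m to state i (1 <= i <= m-1). *)
Definition rate (m i : nat) : R := ((m - i)%:R)^-1.

Definition hold_rate (m : nat) : R := \sum_(1 <= i < m) rate m i.

(* Distribution function t |-> P(D_m <= t) of the absorption time at 1 of the
   chain started at m, obtained from the jump-hold description of the chain:
   it waits an Exp(hold_rate m) time in m, then jumps to i with probability
   rate m i / hold_rate m, independently; D_1 = 0.
   [fuel] is a structural recursion bound (fuel >= m suffices). *)
Fixpoint cdf_aux (fuel m : nat) (t : R) : R :=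
  match fuel with
  | 0 => (if (0 <= t)%R then 1 else 0)
  | fuel'.+1 =>
    if (m <= 1)%N then (if (0 <= t)%R then 1 else 0)
    else
      \int[lebesgue_measure]_(s in `[(0:R), t])
        (hold_rate m * expR (- (hold_rate m * s)) *
          \sum_(1 <= i < m) (rate m i / hold_rate m) * cdf_aux fuel' i (t - s))
  end.

Definition D_cdf (n : nat) (t : R) : R := cdf_aux n n t.

End Defs.

(* Main.v *)
Require Import Defs.
From HB Require Import structures.
From mathcomp Require Import all_boot all_order all_algebra.
From mathcomp Require Import all_classical all_reals all_analysis.
From mathcomp Require Import measurable_realfun.
From mathcomp Require Import zify ring lra.
Set Implicit Arguments. Unset Strict Implicit. Unset Printing Implicit Defensive.
Import Order.TTheory GRing.Theory Num.Theory.
Import numFieldNormedType.Exports.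
Local Open Scope classical_set_scope.
Local Open Scope ring_scope.

(** Write [h m = 1 + 1/2 + ... + 1/(m-1)] for the total jump rate out of [m] and
    [L] for the generator.  Exactly, [L h (m) = - sum_{j<m} 1/j^2], which tends
    to [- zeta 2], and [sum_i rate m i (h m - h i)^2 = sum_{j<m} H_j / j^2],
    which tends to [2 zeta 3] (Euler); the third moments are bounded.  So
    [h (X_t)] behaves like a Brownian motion with drift [- zeta 2] and variance
    rate [2 zeta 3], and [P (D_m <= t)] is sandwiched, by the maximum principle
    for the backward equation, between functions of the form
      [Phi ((zeta 2 t - h m +/- s) / sqrt (zeta 2 ^ 3 t + b)) +/- small],
    where [Phi] is the distribution function of Normal(0, sigma^2) and
    [s, b > 0] smooth the initial condition.  Since the Gaussian profile solves
    the limiting heat equation exactly, a third-order Taylor estimate in [h m]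
    controls the error.  Taking [b] and [s] of order [d^2 ln n] and
    [d sqrt (ln n)], then [n -> oo] and [d -> 0], gives the limit.

    [zeta 2 = pi^2 / 6] is obtained by iterating
    [4 / sin(x)^2 = 1 / sin(x/2)^2 + 1 / sin((pi-x)/2)^2] from [x = pi/2]. *)

(** * Moments of the jumps on the harmonic scale *)

Section HarmonicMoments.
Variable R : realType.

Definition harm (m : nat) : R := \sum_(1 <= k < m) k%:R^-1.

Definition zeta_sum (s N : nat) : R := \sum_(1 <= k < N) (k%:R : R) ^- s.

(** The weights are rates, not jump probabilities, so these are infinitesimal moments of [harm]
    along the chain: [p = 1] gives minus the drift, [p = 2] the variance rate. *)
Definition jump_moment (p m : nat) : R :=
  \sum_(1 <= i < m) rate R m i * (harm m - harm i) ^+ p.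

Lemma harm1 : harm 1 = 0.
Proof. by rewrite /harm big_geq. Qed.

Lemma harmS m : (0 < m)%N -> harm m.+1 = harm m + m%:R^-1.
Proof. by move=> m0; rewrite /harm big_nat_recr. Qed.

Lemma zeta_sumS s N : (0 < N)%N -> zeta_sum s N.+1 = zeta_sum s N + N%:R ^- s.
Proof. by move=> N0; rewrite /zeta_sum big_nat_recr. Qed.

Lemma harm_ge0 m : 0 <= harm m.
Proof. by apply: sumr_ge0 => i _; rewrite invr_ge0. Qed.

Lemma le_harm i m : (i <= m)%N -> harm i <= harm m.
Proof.
case: i => [|i] im; first by rewrite /harm big_geq ?harm_ge0.
rewrite /harm [leRHS](@big_cat_nat _ _ _ i.+1)//= lerDl.
by apply: sumr_ge0 => j _; rewrite invr_ge0.
Qed.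

Lemma hold_rateE m : hold_rate R m = harm m.
Proof.
rewrite /hold_rate /harm big_nat_rev/=; apply: eq_big_nat => i /andP[i1 im].
by rewrite /rate add1n subSS subKn// ltnW.
Qed.

(** Indexing by the jump size [k] makes the weight [1 / k] independent of [m], which opens the way
    to induction on [m]. *)
Lemma jump_momentE p m : jump_moment p m =
  \sum_(1 <= k < m) k%:R^-1 * (harm m - harm (m - k)) ^+ p.
Proof.
rewrite /jump_moment big_nat_rev/=; apply: eq_big_nat => i /andP[i1 im].
by rewrite /rate add1n subSS subKn// ltnW.
Qed.

(* Raising [m] by one changes each increment [harm m - harm (m - k)] by
   [- k / (m (m - k))], which cancels the weight [1 / k]. *)
Lemma jump_momentS p m : (0 < m)%N -> jump_moment p m.+1 = jump_moment p m +
  m%:R^-1 * (harm m.+1 ^+ p - \sum_(1 <= i < m) i%:R^-1 *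
     \sum_(j < p) (harm m.+1 - harm i.+1) ^+ (p.-1 - j) * (harm m - harm i) ^+ j).
Proof.
move=> m0; rewrite !jump_momentE big_nat_recr//= subSnn harm1 subr0.
rewrite [X in _ + _ * (_ - X)]big_nat_rev/= add1n mulrBr addrA addrAC; congr (_ + _).
apply/eqP; rewrite -subr_eq0 opprB addrA addrAC -sumrB mulr_sumr -big_split/=.
apply/eqP; apply: big1_seq => k; rewrite mem_index_iota => /andP[_ /andP[k0 km]].
rewrite subSS subSn; last exact: ltnW.
rewrite -mulrBr subrXX !mulrA -mulrDl; set S := \sum_(j < p) _.
suff -> : k%:R^-1 * (harm m.+1 - harm (m - k).+1 - (harm m - harm (m - k))) +
  m%:R^-1 / (m - k)%:R = 0 by rewrite mul0r.
rewrite (@harmS m) // (@harmS (m - k)) ?subn_gt0// natrB; last exact: ltnW.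
have : (m%:R - k%:R : R) != 0 by rewrite -natrB ?(ltnW km)// pnatr_eq0 subn_eq0 -ltnNge.
have : (m%:R : R) != 0 by rewrite pnatr_eq0 -lt0n.
have : (k%:R : R) != 0 by rewrite pnatr_eq0 -lt0n.
move=> ? ? ?; field; exact/and3P.
Qed.

Lemma jump_moment_at1 p : jump_moment p 1 = 0.
Proof. by rewrite /jump_moment big_geq. Qed.

(** For [p = 1] the inner sum of [jump_momentS] is 1, so the step from [m] adds
    [(harm m.+1 - harm m) / m = 1 / m ^ 2]. *)
Lemma jump_moment1E m : (0 < m)%N -> jump_moment 1 m = zeta_sum 2 m.
Proof.
elim: m => // -[|m] IH _; first by rewrite jump_moment_at1 /zeta_sum big_geq.
rewrite jump_momentS// zeta_sumS// IH//; congr (_ + _).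
under eq_bigr do rewrite big_ord1 !expr0 !mulr1.
rewrite -/(harm _) expr1 (@harmS m.+1)// addrC addKr -exprVn -expr2 //.
Qed.

Lemma jump_moment2E m : (0 < m)%N ->
  jump_moment 2 m = \sum_(1 <= j < m) harm j.+1 * (j%:R ^+ 2)^-1.
Proof.
elim: m => // -[|m] IH _; first by rewrite jump_moment_at1 big_geq.
rewrite jump_momentS// [RHS]big_nat_recr//= IH//; congr (_ + _).
(* Each summand is [(harm m.+2 + harm m.+1) / i - (harm i.+1 ^ 2 - harm i ^ 2)], because
   [harm i.+1 - harm i = 1 / i]; the squares telescope. *)
have -> : \sum_(1 <= i < m.+1) i%:R^-1 * (\sum_(j < 2)
    (harm m.+2 - harm i.+1) ^+ (1 - j) * (harm m.+1 - harm i) ^+ j) =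
  (harm m.+2 + harm m.+1) * harm m.+1 - harm m.+1 ^+ 2.
  have -> : harm m.+1 ^+ 2 = harm m.+1 ^+ 2 - harm 1 ^+ 2 by rewrite harm1 expr0n subr0.
  rewrite -(telescope_sumr (fun i => harm i ^+ 2))//
    [X in _ * X]/harm mulr_sumr -sumrB.
  apply: eq_big_nat => i /andP[i0 im].
  rewrite big_ord_recr big_ord1/= -/(harm _) (@harmS i)//; ring.
rewrite (@harmS m.+1)// -exprVn; ring.
Qed.

Lemma harm_ge1 m : (1 < m)%N -> 1 <= harm m.
Proof.
by move=> m1; have := le_harm m1; rewrite harmS// harm1 invr1 add0r.
Qed.

Lemma jump_moment3S m : (0 < m)%N ->
  jump_moment 3 m.+1 <= jump_moment 3 m + 3 * harm m.+1 ^+ 2 / m%:R ^+ 2.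
Proof.
move=> m0; rewrite jump_momentS// lerD2l.
(* Lowering [harm m.+1] to [harm m] in the inner sum turns each term into a difference of
   consecutive values of [- (harm m - harm i) ^ 3], which telescopes. *)
have S : harm m ^+ 3 <= \sum_(1 <= i < m) i%:R^-1 *
     \sum_(j < 3) (harm m.+1 - harm i.+1) ^+ (3.-1 - j) * (harm m - harm i) ^+ j.
  have -> : harm m ^+ 3 = - (harm m - harm m) ^+ 3 - - (harm m - harm 1) ^+ 3.
    by rewrite subrr harm1 subr0 expr0n oppr0 add0r opprK.
  rewrite -(telescope_sumr (fun i => - (harm m - harm i) ^+ 3))//.
  apply: ler_sum_nat => i /andP[i0 im].
  rewrite !big_ord_recr big_ord0/= !expr0 !expr1 mul1r mulr1 add0r.
  have := le_harm im; have := harmS m0; have := harmS i0.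
  have : 0 <= m%:R^-1 :> R by rewrite invr_ge0.
  have : 0 <= i%:R^-1 :> R by rewrite invr_ge0.
  move: (harm m) (harm m.+1) (harm i) (harm i.+1) (m%:R^-1) (i%:R^-1).
  move=> a a' b b' u w w0 u0 -> -> ba.
  have -> : - (a - (b + w)) ^+ 3 - - (a - b) ^+ 3 = w * ((a - (b + w)) ^+ 2 +
     (a - (b + w)) * (a - b) + (a - b) ^+ 2) by ring.
  rewrite ler_wpM2l// !lerD2r lerD//; last by rewrite ler_wpM2r ?lerD2r ?lerDl//; lra.
  by rewrite ler_sqr ?nnegrE; lra.
have -> : 3 * harm m.+1 ^+ 2 / m%:R ^+ 2 = m%:R^-1 * (3 * harm m.+1 ^+ 2 / m%:R).
  by rewrite -exprVn; ring.
rewrite ler_wpM2l ?invr_ge0//; apply: le_trans (_ : harm m.+1 ^+ 3 - harm m ^+ 3 <= _).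
  by rewrite lerD2l lerN2.
have := harm_ge0 m; rewrite harmS//.
have : 0 <= m%:R^-1 :> R by rewrite invr_ge0.
move: (harm m) (m%:R^-1) => a u u0 a0.
rewrite -subr_ge0 [leRHS](_ : _ = u * (3 * a * u + 2 * u ^+ 2)); last by ring.
by rewrite mulr_ge0// addr_ge0 ?mulr_ge0 ?exprn_ge0//.
Qed.

(* [B] is the discrete analogue of [(ln x ^ 2 + 2 ln x + 2) / x], the
   primitive of [- ln x ^ 2 / x ^ 2]. *)
Lemma jump_moment3_le m : (0 < m)%N -> jump_moment 3 m <= 61.
Proof.
pose B m : R := (harm m.+1 ^+ 2 + 2 * harm m.+1 + 2) / m%:R.
have B0 j : 0 <= B j.
  by rewrite divr_ge0// !addr_ge0// ?exprn_ge0 ?mulr_ge0 ?harm_ge0.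
(* The left-hand side is nonincreasing in [k]; at [k = 0] it equals [1 + 12 * 5], since
   [B 1 = 5]. *)
suff H k : jump_moment 3 k.+2 + 12 * B k.+1 <= 61.
  case: m => // -[_|m _]; first by rewrite jump_moment_at1.
  by apply: le_trans (H m); rewrite lerDl mulr_ge0.
elim: k => [|k IH].
  rewrite /B /jump_moment big_nat1 /rate subSnn invr1 mul1r harmS// harm1.
  by rewrite add0r subr0 invr1 !expr1n; lra.
apply: le_trans IH; have := @jump_moment3S k.+2 isT; rewrite /B.
have h1 : 1 <= harm k.+2 by apply: harm_ge1.
have := @harmS k.+2 isT.
have : k.+2%:R = k.+1%:R + 1 :> R by rewrite -natr1.
have : 1 <= k.+1%:R :> R by rewrite ler1n.
move: (jump_moment 3 _) (jump_moment 3 _) (harm k.+2) (harm k.+3) k.+1%:R k.+2%:R h1.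
move=> J J' h h' n n' h1 n1 -> -> HJ.
set N := n + 1 in HJ *; set u := N^-1 in HJ *.
have n0 : n != 0 by lra.
have N0 : N != 0 by rewrite /N; lra.
have u0 : 0 < u by rewrite invr_gt0 /N; lra.
have nu : 0 < n^-1 by rewrite invr_gt0; lra.
have E : (h ^+ 2 + 2 * h + 2) / n - ((h + u) ^+ 2 + 2 * (h + u) + 2) / N
  - h ^+ 2 / (n * N) = u ^+ 2 * ((2 * h + 1) / n + u * n^-1).
  by rewrite /u /N; field; rewrite n0 -/N N0.
have : 0 <= u ^+ 2 * ((2 * h + 1) / n + u * n^-1).
  by rewrite mulr_ge0 ?exprn_ge0 ?addr_ge0 ?mulr_ge0//; lra.
rewrite -E => {}E.
(* The factor 12 is 3 from [jump_moment3S] times 4 from [h + u <= 2 * h], valid as [u <= 1 <= h]. *)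
have : 3 * (h + u) ^+ 2 / N ^+ 2 <= 12 * (h ^+ 2 / (n * N)).
  rewrite ler_pdivrMr; last by rewrite exprn_gt0// /N; lra.
  rewrite /N.
  have -> : 12 * (h ^+ 2 / (n * (n + 1))) * (n + 1) ^+ 2 = 12 * h ^+ 2 * ((n + 1) / n).
    by field; rewrite n0 -/N N0.
  have : 3 * (h + u) ^+ 2 <= 12 * h ^+ 2.
    have -> : 12 * h ^+ 2 = 3 * (h + h) ^+ 2 by ring.
    rewrite ler_pM2l// ler_sqr ?nnegrE ?lerD2l; [|lra|lra].
    by apply: le_trans h1; rewrite invf_le1 /N//; lra.
  move=> /le_trans; apply; rewrite ler_peMr ?mulr_ge0 ?exprn_ge0// ?(le_trans ler01)//.
  by rewrite ler_pdivlMr; lra.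
rewrite -/u in E => HJ'; lra.
Qed.

End HarmonicMoments.

(** * Limits of the moments *)

Section ZetaLimits.
Variable R : realType.
Implicit Types m : nat.
Local Notation harm := (@harm R).
Local Notation zeta_sum := (@zeta_sum R).

Lemma zeta_sum_nd s : nondecreasing_seq (zeta_sum s).
Proof.
apply/nondecreasing_seqP => -[|n]; first by rewrite /zeta_sum !big_geq.
by rewrite [leRHS]zeta_sumS// lerDl invr_ge0 exprn_ge0.
Qed.

(** From [1 / (x + 1) ^ 2 <= 1 / x - 1 / (x + 1)]: the partial sum plus its integral tail bound
    decreases. *)
Lemma zeta_sum2_tail m k : (0 < m)%N ->
  zeta_sum 2 (m + k).+1 + (m + k)%:R^-1 <= zeta_sum 2 m.+1 + m%:R^-1.
Proof.
move=> m0; elim: k => [|k]; first by rewrite addn0.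
apply: le_trans; rewrite addnS zeta_sumS// -addrA lerD2l -natr1.
have : 1 <= (m + k)%:R :> R by rewrite ler1n addn_gt0 m0.
move: (m + k)%:R => x x1; rewrite -subr_ge0.
have -> : x^-1 - ((x + 1) ^- 2 + (x + 1)^-1) = (x * (x + 1) ^+ 2)^-1.
  by field; apply/andP; split; lra.
by rewrite invr_ge0 mulr_ge0 ?exprn_ge0//; lra.
Qed.

Lemma zeta_sum2_ub m n : (0 < m)%N -> zeta_sum 2 n <= zeta_sum 2 m.+1 + m%:R^-1.
Proof.
move=> m0; apply: le_trans (zeta_sum2_tail n m0).
apply: le_trans (_ : _ <= zeta_sum 2 (m + n).+1) _.
  by apply: zeta_sum_nd; apply: leqW; rewrite leq_addl.
by rewrite lerDl invr_ge0.
Qed.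

Lemma zeta_sum_cvg s : (2 <= s)%N -> zeta_sum s @ \oo --> zeta R s.
Proof.
move=> s2; apply: (@nondecreasing_is_cvgn _ (zeta_sum s)).
  exact: zeta_sum_nd.
exists 2 => _ [n _ <-]; apply: le_trans (_ : zeta_sum 2 n <= 2).
  apply: ler_sum_nat => k /andP[k0 _]; rewrite lef_pV2 ?posrE ?exprn_gt0 ?ltr0n//.
  by rewrite ler_weXn2l// ler1n.
apply: le_trans (zeta_sum2_ub n (ltn0Sn 0)) _.
by rewrite /zeta_sum big_nat1 expr1n invr1; lra.
Qed.

Lemma zeta_sum_le s m : (2 <= s)%N -> zeta_sum s m <= zeta R s.
Proof.
move=> s2; apply: nondecreasing_cvgn_le (@zeta_sum_nd s) _ m.
by apply: cvgP; exact: zeta_sum_cvg.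
Qed.

Lemma zeta_ge1 s : (2 <= s)%N -> 1 <= zeta R s.
Proof.
by move=> /(zeta_sum_le 2); rewrite /zeta_sum big_nat1 expr1n invr1.
Qed.

Lemma zeta2_le m : (1 < m)%N -> zeta R 2 <= zeta_sum 2 m + 2 / m%:R.
Proof.
case: m => // m m1; apply: limr_le; first by apply: cvgP; exact: zeta_sum_cvg.
apply: nearW => n; apply: le_trans (zeta_sum2_ub n (m1 : (0 < m)%N)) _.
rewrite lerD2l ler_pdivlMr ?ltr0n// mulrC ler_pdivrMr ?ltr0n// -natr1.
have : 1 <= m%:R :> R by rewrite ler1n.
lra.
Qed.

(** Passing from [m] to [m.+1] adds the diagonal [j + k = m], on which
    [1 / (j k) = (1 / j + 1 / k) / m]; its sum is [2 * harm m / m ^ 2]. *)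
Lemma euler_triangle m :
  \sum_(1 <= j < m) \sum_(1 <= k < m - j) (j%:R * k%:R * (j + k)%:R)^-1 =
  \sum_(1 <= n < m) 2 * harm n / n%:R ^+ 2.
Proof.
elim: m => [|m IH]; first by rewrite !big_geq.
have [->|m0] := posnP m; first by rewrite !big_geq.
rewrite [RHS]big_nat_recr//= -IH big_nat_recr//= subSnn [X in _ + X]big_geq// addr0.
have E j : (1 <= j < m)%N -> \sum_(1 <= k < m.+1 - j) (j%:R * k%:R * (j + k)%:R)^-1 =
   \sum_(1 <= k < m - j) (j%:R * k%:R * (j + k)%:R)^-1 +
   (j%:R^-1 + (m - j)%:R^-1) / m%:R ^+ 2 :> R.
  move=> /andP[j0 jm]; rewrite subSn ?(ltnW jm)// big_nat_recr ?subn_gt0//=.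
  congr (_ + _); rewrite subnKC ?(ltnW jm)// natrB ?(ltnW jm)//.
  have : (m%:R - j%:R : R) != 0 by rewrite -natrB ?(ltnW jm)// pnatr_eq0 subn_eq0 -ltnNge.
  have : (m%:R : R) != 0 by rewrite pnatr_eq0 -lt0n.
  have : (j%:R : R) != 0 by rewrite pnatr_eq0 -lt0n.
  by move=> ? ? ?; field; exact/and3P.
rewrite (eq_big_nat _ _ E) big_split/=; congr (_ + _).
rewrite -mulr_suml big_split/= -/(harm m).
have := hold_rateE R m; rewrite /hold_rate /rate => ->.
by rewrite -mulr2n mulr_natl.
Qed.

Lemma harm_shift m j : (0 < m)%N -> harm (m + j) - harm m <= j%:R / m%:R.
Proof.
move=> m0; elim: j => [|j IH]; first by rewrite addn0 subrr mul0r.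
rewrite addnS harmS ?addn_gt0 ?m0// addrAC -natr1 mulrDl mul1r lerD//.
by rewrite lef_pV2 ?posrE ?ltr0n ?addn_gt0 ?m0// ler_nat leq_addr.
Qed.

Lemma sum_harm_shift m j : (0 < m)%N ->
  \sum_(1 <= k < m) (j + k)%:R^-1 = harm (m + j) - harm j.+1.
Proof.
elim: m => // -[|m] IH _; first by rewrite big_geq// add1n subrr.
by rewrite big_nat_recr//= IH// (@harmS _ (m.+1 + j))// (addnC j) addrAC.
Qed.

(* Euler: with [S = sum H_j / j ^ 2], partial fractions evaluate
   [sum 1 / (j k (j + k))] both as [S] (sum over [k] first) and as
   [2 (S - zeta 3)] (along the diagonals [j + k = n]), whence [S = 2 zeta 3]. *)
Lemma jump_moment2_approx m : (0 < m)%N ->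
  `|jump_moment R 2 m - 2 * zeta_sum 3 m| <= (harm m ^+ 2 + harm m) / m%:R.
Proof.
move=> m0; rewrite jump_moment2E//; set S := \sum_(1 <= j < m) _.
(* [P] runs over the square [j, k < m], and [Q] equals the sum over the triangle [j + k < m]. As
   [S - Q = 2 * zeta_sum 3 m - S], it remains to bound [S - P] (tails in [k]) and [P - Q] (where
   [j + k >= m]). *)
pose P : R := \sum_(1 <= j < m) \sum_(1 <= k < m) (j%:R * k%:R * (j + k)%:R)^-1.
pose Q : R := \sum_(1 <= n < m) 2 * harm n / n%:R ^+ 2.
have QE : Q = 2 * S - 2 * zeta_sum 3 m.
  rewrite /Q /S /zeta_sum !mulr_sumr -sumrB; apply: eq_big_nat => j /andP[j0 _].
  rewrite harmS//; have : (j%:R : R) != 0 by rewrite pnatr_eq0 -lt0n.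
  by move=> ?; field.
have SP : 0 <= S - P <= harm m / m%:R.
  have E j : (1 <= j < m)%N -> harm j.+1 / j%:R ^+ 2 -
     \sum_(1 <= k < m) (j%:R * k%:R * (j + k)%:R)^-1 =
     (harm (m + j) - harm m) / j%:R ^+ 2.
    move=> /andP[j0 jm].
    have <- : (harm m - (harm (m + j) - harm j.+1)) / j%:R ^+ 2 =
      \sum_(1 <= k < m) (j%:R * k%:R * (j + k)%:R)^-1.
      rewrite -sum_harm_shift// {1}/harm -sumrB mulr_suml.
      apply: eq_big_nat => k /andP[k0 km]; rewrite natrD.
      have : (k%:R : R) != 0 by rewrite pnatr_eq0 -lt0n.
      have : (j%:R : R) != 0 by rewrite pnatr_eq0 -lt0n.
      have : (j%:R + k%:R : R) != 0 by rewrite -natrD pnatr_eq0 -lt0n addn_gt0 j0.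
      by move=> ? ? ?; field; exact/and3P.
    by rewrite -mulrBl; congr (_ / _); ring.
  rewrite /S /P -sumrB (eq_big_nat _ _ E); apply/andP; split.
    apply: sumr_ge0 => j _; rewrite divr_ge0 ?exprn_ge0// subr_ge0.
    by apply: le_harm; rewrite leq_addr.
  rewrite /harm mulr_suml; apply: ler_sum_nat => j /andP[j0 jm].
  rewrite ler_pdivrMr ?exprn_gt0 ?ltr0n//; apply: le_trans (harm_shift j m0) _.
  have : (j%:R : R) != 0 by rewrite pnatr_eq0 -lt0n.
  have : (m%:R : R) != 0 by rewrite pnatr_eq0 -lt0n.
  move=> ? ?; rewrite [leRHS](_ : _ = j%:R / m%:R)//; field; exact/andP.
have PQ : 0 <= P - Q <= harm m ^+ 2 / m%:R.
  rewrite /P /Q -euler_triangle -sumrB.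
  have E j : (1 <= j < m)%N -> \sum_(1 <= k < m) (j%:R * k%:R * (j + k)%:R)^-1 -
    \sum_(1 <= k < m - j) (j%:R * k%:R * (j + k)%:R)^-1 =
    \sum_(m - j <= k < m) (j%:R * k%:R * (j + k)%:R)^-1 :> R.
    move=> /andP[j0 jm].
    by rewrite (@big_cat_nat _ _ _ (m - j))/= ?subn_gt0 ?leq_subr// addrAC subrr add0r.
  rewrite (eq_big_nat _ _ E); apply/andP; split.
    by apply: sumr_ge0 => j _; apply: sumr_ge0 => k _; rewrite invr_ge0 !mulr_ge0.
  rewrite expr2 -mulrA {1}/harm mulr_suml.
  apply: ler_sum_nat => j /andP[j0 jm].
  apply: le_trans (_ : \sum_(m - j <= k < m) j%:R^-1 * (k%:R^-1 / m%:R) <= _).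
    apply: ler_sum_nat => k /andP[k0 km].
    have kp : (0 < k)%N by apply: leq_trans k0; rewrite subn_gt0.
    rewrite -!invfM lef_pV2 ?posrE ?mulr_gt0 ?ltr0n ?addn_gt0 ?j0//.
    by rewrite -mulrA ler_wpM2l// ler_wpM2l// ler_nat -leq_subLR.
  rewrite -mulr_sumr ler_wpM2l ?invr_ge0// -mulr_suml ler_wpM2r ?invr_ge0//.
  rewrite /harm [leRHS](@big_cat_nat _ _ _ (m - j))/= ?subn_gt0 ?leq_subr// lerDr.
  by apply: sumr_ge0 => k _; rewrite invr_ge0.
have D : (harm m ^+ 2 + harm m) / m%:R = harm m ^+ 2 / m%:R + harm m / m%:R.
  by rewrite mulrDl.
rewrite ler_norml; move: QE SP PQ => -> /andP[? ?] /andP[? ?].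
by apply/andP; split; lra.
Qed.

Lemma ln_le_harm m : (0 < m)%N -> ln m%:R <= harm m.
Proof.
elim: m => // -[|m] IH _; first by rewrite ln1 harm1.
rewrite harmS//; apply: le_trans (lerD (IH isT) (lexx _)).
rewrite -lerBlDl -ln_div ?posrE ?ltr0n// -natr1 mulrDl divff ?pnatr_eq0// mul1r.
by apply: le_ln1Dx; rewrite (lt_le_trans (ltrN10 _))// invr_ge0.
Qed.

Lemma harm_le_ln m : (0 < m)%N -> harm m <= 1 + ln m%:R.
Proof.
(* The extra [- 1 / m] strengthens the induction: it cancels the next term [1 / m] of [harm]. *)
move=> m0; apply: le_trans (_ : 1 + ln m%:R - m%:R^-1 <= _); last first.
  by rewrite gerBl invr_ge0.
case: m m0 => // m _; elim: m => [|m IH]; first by rewrite ln1 harm1 invr1; lra.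
rewrite harmS//; apply: le_trans (lerD IH (lexx _)) _; rewrite subrK -addrA lerD2l.
suff : ln (m.+1%:R / m.+2%:R) <= - m.+2%:R^-1 :> R.
  rewrite ln_div ?posrE ?ltr0n//.
  by move: (ln (m.+1%:R : R)) (ln (m.+2%:R : R)) (m.+2%:R^-1 : R) => a b c; lra.
have -> : m.+1%:R / m.+2%:R = 1 + - m.+2%:R^-1 :> R.
  by rewrite -[m.+1%:R](addrK 1) natr1 mulrBl divff ?pnatr_eq0// mul1r.
apply: le_ln1Dx.
by rewrite ltrN2 invf_lt1 ?ltr0n// ltr1n.
Qed.

Lemma cvg_ln_nat : ln (n%:R : R) @[n --> \oo] --> +oo.
Proof.
apply/cvgryPge => A; near=> n.
have : expR A <= n%:R by near: n; exact: nbhs_infty_ger.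
move=> An; rewrite -(expRK A) ler_ln ?posrE ?expR_gt0//.
by apply: lt_le_trans An; rewrite expR_gt0.
Unshelve. all: by end_near. Qed.

(** With [l = ln m], the exponential series gives [m >= 1 + l ^ 3 / 6], while the numerator times
    [l] is at most [2 * (1 + l) ^ 3], hence at most 16 times the larger of 1 and [l ^ 3]; and
    [96 = 6 * 16]. *)
Lemma harm_sq_div_le m : (1 < m)%N -> (harm m ^+ 2 + harm m) / m%:R <= 96 / ln m%:R.
Proof.
move=> m1; have m0 : (0 < m)%N by exact: ltnW.
have l0 : 0 < ln m%:R :> R by rewrite ln_gt0// ltr1n.
have h1 := @harm_ge1 R _ m1.
have hl := harm_le_ln m0.
have e3 : 1 + ln m%:R ^+ 3 / 6 <= m%:R :> R.
  by have := @expR_ge1Dxn R _ 2 (ltW l0); rewrite lnK ?posrE ?ltr0n.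
rewrite ler_pdivrMr ?ltr0n// mulrAC ler_pdivlMr//.
have := ln_le_harm m0.
move: (harm m) (m%:R : R) (ln (m%:R : R)) l0 h1 hl e3 => h x l l0 h1 hl e3 lh.
apply: le_trans (_ : 2 * (1 + l) ^+ 3 <= _).
  apply: le_trans (_ : (2 * h ^+ 2) * h <= _).
    apply: ler_pM => //; [by rewrite addr_ge0 ?exprn_ge0//; lra|lra|].
    by rewrite expr2; nra.
  by rewrite -mulrA -exprSr ler_wpM2l// lerXn2r ?nnegrE; lra.
apply: le_trans (_ : 96 * (1 + l ^+ 3 / 6) <= _); last by rewrite ler_wpM2l.
rewrite -subr_ge0.
have -> : 96 * (1 + l ^+ 3 / 6) - 2 * (1 + l) ^+ 3 = 86 + 14 * l ^+ 3 - 6 * l ^+ 2 - 6 * l + 8 by field.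
have [l1|l1] := leP l 1; last by nra.
have : l ^+ 2 <= 1 by rewrite expr_le1// ltW.
have : 0 <= l ^+ 3 by rewrite exprn_ge0// ltW.
lra.
Qed.

Lemma cvg_jump_moment2 : jump_moment R 2 @ \oo --> 2 * zeta R 3.
Proof.
have z : 2 * zeta_sum 3 n @[n --> \oo] --> 2 * zeta R 3.
  by apply: cvgMr; exact: zeta_sum_cvg.
suff d : (jump_moment R 2 n - 2 * zeta_sum 3 n) @[n --> \oo] --> (0 : R).
  rewrite (_ : jump_moment R 2 = fun n => (jump_moment R 2 n - 2 * zeta_sum 3 n) +
    2 * zeta_sum 3 n); last by apply/funext => n; rewrite subrK.
  by rewrite -[X in _ --> X]add0r; exact: cvgD.
apply/norm_cvg0P; apply: (@squeeze_cvgr _ _ _ _ (cst 0) (fun n : nat => 96 / ln (n%:R : R))).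
- near=> n; rewrite normr_ge0/=.
  have n1 : (1 < n)%N by near: n; exact: nbhs_infty_gt.
  by apply: le_trans (jump_moment2_approx (ltnW n1)) (harm_sq_div_le n1).
- exact: cvg_cst.
- rewrite -[X in _ --> X](mulr0 96); apply: cvgMr.
  apply/gtr0_cvgV0; last exact: cvg_ln_nat.
  by near=> n; rewrite ln_gt0// ltr1n; near: n; exact: nbhs_infty_gt.
Unshelve. all: by end_near. Qed.

Lemma jump_moment2_le m : (0 < m)%N -> jump_moment R 2 m <= 2 * zeta R 3.
Proof.
move=> m0; have nd : nondecreasing_seq (jump_moment R 2).
  apply/nondecreasing_seqP => -[|n]; first by rewrite /jump_moment !big_geq.
  rewrite !jump_moment2E// [leRHS]big_nat_recr//= lerDl divr_ge0 ?harm_ge0//.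
rewrite -(cvg_lim _ cvg_jump_moment2)//; apply: nondecreasing_cvgn_le => //.
by apply: cvgP; exact: cvg_jump_moment2.
Qed.

(** Convergence handles [m >= N], and [C = zeta 3 * N] covers [m < N]. The shape [e + C / m] is what
    the barrier can absorb: [e] through [harm m], [C / m] through [1 - 1 / m]. *)
Lemma jump_moment2_near (e : R) : 0 < e -> exists2 C : R, 0 <= C &
  forall m, (0 < m)%N -> `|zeta R 3 - jump_moment R 2 m / 2| <= e + C / m%:R.
Proof.
move=> e0; have z0 : 0 <= zeta R 3 by apply: le_trans (@zeta_ge1 3 isT).
have /cvgrPdist_le/(_ e e0)[N _ HN] := cvg_jump_moment2.
exists (zeta R 3 * N%:R) => [|m m0]; first by rewrite mulr_ge0.
have T2 := jump_moment2_le m0.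
have T0 : 0 <= jump_moment R 2 m.
  rewrite jump_moment2E//; apply: sumr_ge0 => j _.
  by rewrite divr_ge0 ?harm_ge0 ?exprn_ge0.
have [Nm|mN] := leP N m.
  have := HN _ Nm; rewrite ger0_norm ?subr_ge0//= => HN'.
  rewrite ger0_norm; last lra.
  have : 0 <= zeta R 3 * N%:R / m%:R by rewrite !mulr_ge0 ?invr_ge0.
  lra.
rewrite ger0_norm; last lra.
have : zeta R 3 * 1 <= zeta R 3 * (N%:R / m%:R).
  by rewrite ler_wpM2l// ler_pdivlMr ?ltr0n// mul1r ler_nat ltnW.
rewrite mulr1 mulrA; lra.
Qed.

End ZetaLimits.

(** * The Basel problem *)

Section Basel.
Variable R : realType.

Lemma mvt_segment (f df : R -> R) (a b : R) : a <= b ->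
  (forall x, a <= x <= b -> is_derive x 1 f (df x)) ->
  exists2 c, a <= c <= b & f b - f a = df c * (b - a).
Proof.
move=> ab dfE; have [||c] := @MVT_segment R f df a b ab.
- by move=> x /[!in_itv]/= /andP[/ltW ax /ltW xb]; apply: dfE; rewrite ax xb.
- apply: derivable_within_continuous => x /[!in_itv]/= axb.
  by have [] := dfE _ axb.
- by rewrite in_itv/= => cab fE; exists c.
Qed.

Lemma sin_bounds (x : R) : 0 < x < pi / 2 -> x * cos x <= sin x <= x.
Proof.
move=> /andP[x0 xpi]; apply/andP; split.
  have [||c /andP[c0 cx]] := @mvt_segment (fun t => sin t - t * cos t)
      (fun t => t * sin t) 0 x.
  - exact: ltW.
  - move=> y _; apply: is_derive_eq.
    by rewrite /GRing.scale/=; ring.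
  - rewrite sin0 mul0r !subr0 -subr_ge0 => ->.
    rewrite mulr_ge0 ?mulr_ge0 ?(ltW x0)// sin_ge0_pi// c0/=.
    by apply: le_trans cx _; have := @pi_ge0 R; lra.
have [c _] := @mvt_segment sin cos 0 x (ltW x0).
rewrite sin0 !subr0 => ->; by rewrite ler_piMl ?(ltW x0)// (le_trans (ler_norm _) (cos_max _)).
Qed.

Local Notation csc2 x := ((sin x ^+ 2)^-1).

(** [sin_bounds] says that [1 / x] lies between the cotangent and the cosecant of [x], whose squares
    differ by 1. *)
Lemma csc2_bounds (x : R) : 0 < x < pi / 2 -> (x ^+ 2)^-1 <= csc2 x <= (x ^+ 2)^-1 + 1.
Proof.
move=> xI; have /andP[cs sx] := sin_bounds xI.
have s0 := sin_gt0_pihalf xI; have /andP[x0 _] := xI.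
rewrite lef_pV2 ?posrE ?exprn_gt0// lerXn2r ?nnegrE ?(ltW s0) ?(ltW x0)//=.
have -> : csc2 x = csc2 x * (cos x ^+ 2 + sin x ^+ 2) by rewrite cos2Dsin2 mulr1.
rewrite mulrDr mulVf ?gt_eqF ?exprn_gt0// lerD2r mulrC.
rewrite ler_pdivrMr ?exprn_gt0// mulrC ler_pdivlMr ?exprn_gt0// -exprMn mulrC.
have c0 : 0 <= cos x.
  by apply: cos_ge0_pihalf; have := @pi_ge0 R; case/andP: xI => ? ? ?; apply/andP; split; lra.
by rewrite lerXn2r ?nnegrE ?mulr_ge0 ?(ltW s0) ?(ltW x0)//.
Qed.

Lemma csc2_half (x : R) : 0 < x < pi ->
  4 * csc2 x = csc2 (x / 2) + csc2 ((pi - x) / 2).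
Proof.
move=> /andP[x0 xpi].
have -> : (pi - x) / 2 = - (x / 2 - pi / 2) by field.
rewrite sinN sinBpihalf opprK.
have s0 : sin (x / 2) != 0.
  by rewrite gt_eqF// sin_gt0_pi//; apply/andP; split; lra.
have c0 : cos (x / 2) != 0.
  by rewrite gt_eqF// cos_gt0_pihalf//; apply/andP; split; lra.
have -> : sin x = 2 * (sin (x / 2) * cos (x / 2)).
  have {1}-> : x = (x / 2) *+ 2 by rewrite -mulr_natr; field.
  by rewrite sin_mulr2n -mulr_natl; ring.
have := cos2Dsin2 (x / 2); move: (cos _) (sin _) c0 s0 => c s c0 s0 cs.
have -> : s ^- 2 + c ^- 2 = (c ^+ 2 + s ^+ 2) / (s * c) ^+ 2 by field; exact/andP.
by rewrite cs; field; exact/andP.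
Qed.

(** The angles are the odd multiples of [pi / 2 ^ (n + 2)] below [pi / 2]. [csc2_half] splits each
    [x] into [x / 2], in the lower half of the next family, and [(pi - x) / 2], in its upper half
    read backwards, so the sum is multiplied by 4. It starts from [csc2 (pi / 4) = 2]. *)
Lemma sum_csc2 n : \sum_(0 <= k < 2 ^ n) csc2 ((2 * k + 1)%:R * (pi / 2 ^+ n.+2)) =
  2 * 4 ^+ n :> R.
Proof.
elim: n => [|n IH].
  rewrite big_nat1 muln0 add0n mul1r expr0 mulr1.
  have -> : pi / 2 ^+ 2 = pi / 2 / 2 :> R by field.
  have := @csc2_half (pi / 2); have -> : (pi - pi / 2) / 2 = pi / 2 / 2 :> R by field.
  rewrite sin_pihalf expr1n invr1 => /(_ _) H.
  have : (0 : R) < pi / 2 < (pi : R) by have := @pi_gt0 R; move=> ?; apply/andP; split; lra.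
  by move=> /H {H}; lra.
rewrite (@big_cat_nat _ _ _ (2 ^ n))//=; last by rewrite leq_exp2l.
have -> : \sum_(2 ^ n <= k < 2 ^ n.+1) csc2 ((2 * k + 1)%:R * (pi / 2 ^+ n.+3)) =
  \sum_(0 <= k < 2 ^ n) csc2 ((pi - (2 * k + 1)%:R * (pi / 2 ^+ n.+2)) / 2) :> R.
  rewrite [LHS](_ : _ = \sum_(0 + 2 ^ n <= k < 2 ^ n + 2 ^ n)
    csc2 ((2 * k + 1)%:R * (pi / 2 ^+ n.+3))); last first.
    by rewrite add0n addnn -mul2n -expnS.
  rewrite big_addn addnK big_nat_rev; apply: eq_big_nat => k /andP[_ kn].
  congr (sin _ ^+ 2)^-1.
  rewrite add0n natrD natrM natrD natrB// natrX natrD natrM -natr1 !exprS.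
  have : (2 : R) ^+ n != 0 by rewrite expf_neq0.
  by move=> ?; field.
rewrite -big_split/= [4 ^+ _]exprS mulrCA -IH mulr_sumr; apply: eq_big_nat => k /andP[_ kn].
rewrite csc2_half.
  congr ((sin _ ^+ 2)^-1 + _); rewrite [in LHS]exprS invfM; ring.
have p0 : 0 < (2 : R) ^+ n by rewrite exprn_gt0.
have pi0 := @pi_gt0 R.
apply/andP; split; first by rewrite mulr_gt0 ?divr_gt0 ?ltr0n ?addn1 ?exprn_gt0.
rewrite mulrA ltr_pdivrMr ?exprn_gt0// mulrC ltr_pM2l// -natrX ltr_nat !expnS; lia.
Qed.

Lemma zeta_sum_odd N : zeta_sum R 2 (2 * N).+1 =
  \sum_(0 <= k < N) ((2 * k + 1)%:R ^+ 2)^-1 + 4^-1 * zeta_sum R 2 N.+1.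
Proof.
elim: N => [|N IH]; first by rewrite /zeta_sum !big_geq// mulr0 addr0.
rewrite mulnS add2n (@zeta_sumS _ _ (2 * N).+2)// (@zeta_sumS _ _ (2 * N).+1)// IH big_nat_recr//= (@zeta_sumS _ _ N.+1)// addn1.
have : (N.+1%:R : R) != 0 by rewrite pnatr_eq0.
have -> : ((2 * N).+2)%:R = 2 * N.+1%:R :> R by rewrite -natrM; congr (_%:R); lia.
have : ((2 * N).+1%:R : R) != 0 by rewrite pnatr_eq0.
by move: (N.+1%:R) ((2 * N).+1%:R) => x y y0 x0; field; rewrite x0.
Qed.

(** Inverse squares of odd numbers sum to [3 / 4] of [zeta 2], and [sum_csc2] forces this to be
    [pi ^ 2 / 8]: [csc2_bounds] errs by at most 1 at each of the [N = 2 ^ n] angles, against sums of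
    order [N ^ 2]. *)
Lemma zeta2E : zeta R 2 = pi ^+ 2 / 6.
Proof.
have pi0 := @pi_gt0 R.
have H n : `|zeta R 2 * (3 / 4) - pi ^+ 2 / 8| <= (4 + pi ^+ 2) * harmonic n.
  set N := (2 ^ n)%N; pose O : R := \sum_(0 <= k < N) ((2 * k + 1)%:R ^+ 2)^-1.
  have N0 : (0 < N)%N by rewrite expn_gt0.
  have NR : N%:R = 2 ^+ n :> R by rewrite natrX.
  have N0' : 0 < 2 ^+ n :> R by rewrite exprn_gt0.
  have angle k : (k < N)%N -> (0 : R) < (2 * k + 1)%:R * (pi / 2 ^+ n.+2) < (pi / 2 : R).
    move=> kN; rewrite mulr_gt0 ?divr_gt0 ?ltr0n ?addn1 ?exprn_gt0//=.
    rewrite mulrA ltr_pdivrMr ?exprn_gt0// mulrC mulrAC -mulrA ltr_pM2l//.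
    rewrite exprS mulrAC divff// mul1r exprS -NR -natrM ltr_nat; lia.
  have OE : \sum_(0 <= k < N) (((2 * k + 1)%:R * (pi / 2 ^+ n.+2)) ^+ 2)^-1 =
      16 * 4 ^+ n / pi ^+ 2 * O.
    rewrite mulr_sumr; apply: eq_bigr => k _; rewrite exprMn invfM mulrC; congr (_ * _).
    have -> : 4 ^+ n = (2 ^+ n) ^+ 2 :> R by rewrite exprAC; congr (_ ^+ n); ring.
    rewrite (exprS 2 n.+1) (exprS 2 n); 
    move: (2 ^+ n : R) (pi : R) N0' pi0 => y p y0 p0.
    by field; rewrite !gt_eqF.
  have lo : 16 * 4 ^+ n / pi ^+ 2 * O <= 2 * 4 ^+ n.
    rewrite -OE -sum_csc2; apply: ler_sum_nat => k /andP[_ kN].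
    by have /andP[] := csc2_bounds (angle _ kN).
  have hi : 2 * 4 ^+ n <= 16 * 4 ^+ n / pi ^+ 2 * O + N%:R.
    rewrite -OE -sum_csc2.
    have -> : N%:R = \sum_(0 <= k < N) 1 :> R by rewrite big_const_nat subn0 iter_addr_0.
    rewrite -big_split/=; apply: ler_sum_nat => k /andP[_ kN].
    by have /andP[] := csc2_bounds (angle _ kN).
  have q0 : 0 < 4 ^+ n :> R by rewrite exprn_gt0.
  have qE : 4 ^+ n = N%:R ^+ 2 :> R.
    by rewrite NR exprAC; congr (_ ^+ n); ring.
  have NR0 : 0 < N%:R :> R by rewrite ltr0n.
  have lo' : O <= pi ^+ 2 / 8.
    rewrite -(@ler_pM2l _ (16 * 4 ^+ n / pi ^+ 2)) ?divr_gt0 ?mulr_gt0 ?exprn_gt0//.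
    apply: le_trans lo _; rewrite le_eqVlt; apply/orP; left; apply/eqP.
    by move: (pi : R) pi0 => p p0; field; rewrite gt_eqF.
  have hi' : pi ^+ 2 / 8 <= O + pi ^+ 2 / 16 / N%:R.
    rewrite -(@ler_pM2l _ (16 * 4 ^+ n / pi ^+ 2)) ?divr_gt0 ?mulr_gt0 ?exprn_gt0//.
    rewrite mulrDr [leLHS](_ : _ = 2 * 4 ^+ n); last by move: (pi : R) pi0 => p p0; field; rewrite gt_eqF.
    rewrite [X in _ + X](_ : _ = N%:R)// qE.
    move: (pi : R) (N%:R : R) pi0 NR0 => p y p0 y0.
    by field; rewrite !gt_eqF.
  have zO := zeta_sum_odd N; rewrite -/O in zO.
  have z1 : zeta_sum R 2 (2 * N).+1 <= zeta R 2 by exact: zeta_sum_le.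
  have z2 : zeta_sum R 2 N.+1 <= zeta R 2 by exact: zeta_sum_le.
  have z3 := @zeta2_le R (2 * N).+1; have z4 := @zeta2_le R N.+1.
  have {}z3 : zeta R 2 <= zeta_sum R 2 (2 * N).+1 + 2 / N%:R.
    apply: (le_trans (z3 _)); first by rewrite ltnS muln_gt0.
    by rewrite lerD2l ler_pM2l// lef_pV2 ?posrE ?ltr0n// ler_nat leqW// leq_pmull.
  have {}z4 : zeta R 2 <= zeta_sum R 2 N.+1 + 2 / N%:R.
    apply: (le_trans (z4 _)); first by rewrite ltnS.
    by rewrite lerD2l ler_pM2l// lef_pV2 ?posrE ?ltr0n// ler_nat.
  have Nh : N%:R^-1 <= harmonic n :> R.
    by rewrite /harmonic/= lef_pV2 ?posrE ?ltr0n// ler_nat ltn_expl.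
  apply: le_trans (_ : (4 + pi ^+ 2) * N%:R^-1 <= _); last first.
    by rewrite ler_wpM2l// addr_ge0// sqr_ge0.
  have i0 : 0 < N%:R^-1 :> R by rewrite invr_gt0.
  have : 0 < pi ^+ 2 * N%:R^-1 :> R by rewrite mulr_gt0 ?exprn_gt0.
  rewrite ler_norml mulrDl; move: zO z1 z2 z3 z4 lo' hi' i0.
  rewrite [pi ^+ 2 / 16 / N%:R]mulrAC.
  move: (pi ^+ 2 / N%:R : R) (N%:R^-1 : R) (pi ^+ 2 : R) => a b c.
  by move=> *; apply/andP; split; lra.
suff : `|zeta R 2 * (3 / 4) - pi ^+ 2 / 8| <= 0.
  by rewrite normr_le0 subr_eq0 => /eqP; lra.
have c : (4 + pi ^+ 2) * harmonic n @[n --> \oo] --> (0 : R).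
  by rewrite -[X in _ --> X](mulr0 (4 + pi ^+ 2)); apply: cvgMr; exact: cvg_harmonic.
rewrite -(cvg_lim _ c)//; apply: limr_ge; first by apply: cvgP c.
exact: nearW.
Qed.

End Basel.

(** * The maximum principle *)

Section Comparison.
Variable R : realType.
Local Notation mu := (@lebesgue_measure R).

Lemma is_derive_continuous (f : R -> R) (x d : R) : is_derive x 1 f d ->
  {for x, continuous f}.
Proof. by move=> [/derivable1_diffP/differentiable_continuous]. Qed.

Lemma Rintegral_FTC2 (f F : R -> R) (a b : R) : a <= b ->
  (forall x, a <= x <= b -> is_derive x 1 F (f x)) ->
  (forall x, a <= x <= b -> {for x, continuous f}) ->
  mu.-integrable `[a, b] (EFin \o f) /\
  \int[mu]_(x in `[a, b]) f x = F b - F a.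
Proof.
move=> ab dF cf.
have wcf : {within `[a, b], continuous f}.
  apply: continuous_in_subspaceT => x; rewrite inE/= in_itv/=; exact: cf.
split; first by apply: continuous_compact_integrable => //; exact: segment_compact.
move: ab; rewrite le_eqVlt => /predU1P[<-|ab].
  by rewrite set_itv1 Rintegral_set1 subrr.
have cF x : a <= x <= b -> {for x, continuous F}.
  by move=> /dF; exact: is_derive_continuous.
rewrite /Rintegral (@continuous_FTC2 _ f F)// -?EFinB//; first split.
- by move=> x; rewrite in_itv/= => /andP[/ltW ax /ltW xb]; case: (dF x); rewrite ?ax ?xb.
- by apply: cvg_at_right_filter; apply: cF; rewrite lexx ltW.
- by apply: cvg_at_left_filter; apply: cF; rewrite lexx ltW.
- move=> x; rewrite in_itv/= => /andP[/ltW ax /ltW xb]; rewrite derive1E.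
  by have [|_ ->] := dF x; rewrite ?ax ?xb.
Qed.

(** Law of the time still to run after the first jump out of [m]. *)
Definition jump_cdf (fuel m : nat) (t : R) : R :=
  \sum_(1 <= i < m) (rate R m i / hold_rate R m) * cdf_aux fuel i t.

Lemma cdf_auxS fuel m t : (1 < m)%N -> cdf_aux fuel.+1 m t =
  \int[mu]_(s in `[0, t]) (hold_rate R m * expR (- (hold_rate R m * s)) *
    jump_cdf fuel m (t - s)).
Proof. by move=> m1 /=; rewrite leqNgt m1. Qed.

Lemma cdf_aux_le1 fuel m t : (m <= 1)%N -> @cdf_aux R fuel m t = if 0 <= t then 1 else 0.
Proof. by case: fuel => //= n ->. Qed.

Lemma hold_rate_gt0 m : (1 < m)%N -> 0 < hold_rate R m.
Proof. by move=> m1; rewrite hold_rateE (lt_le_trans ltr01)// harm_ge1. Qed.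

Lemma rate_ge0 m i : 0 <= rate R m i.
Proof. by rewrite invr_ge0. Qed.

Lemma sum_jump_prob m : (1 < m)%N -> \sum_(1 <= i < m) rate R m i / hold_rate R m = 1.
Proof. by move=> m1; rewrite -mulr_suml divff// gt_eqF// hold_rate_gt0. Qed.

Lemma is_derive_expNM (h x : R) :
  is_derive x 1 (fun s => expR (- (h * s))) (- (h * expR (- (h * x)))).
Proof.
have -> : - (h * expR (- (h * x))) = expR (- (h * x)) * - h by ring.
apply: (@is_derive1_comp _ expR (fun s => - (h * s))).
by apply: is_derive_eq; rewrite /GRing.scale/=; ring.
Qed.

Lemma exp_kernel_integral (h t : R) : 0 <= t ->
  mu.-integrable `[0, t] (EFin \o (fun s => h * expR (- (h * s)))) /\
  \int[mu]_(s in `[0, t]) (h * expR (- (h * s))) = 1 - expR (- (h * t)).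
Proof.
move=> t0.
have [||? ->] := @Rintegral_FTC2 (fun s => h * expR (- (h * s)))
  (fun s => - expR (- (h * s))) 0 t t0.
- move=> x _; have ? := is_derive_expNM h x.
  by apply: is_derive_eq; rewrite opprK.
- move=> x _; apply: cvgMr; exact: (is_derive_continuous (is_derive_expNM h x)).
- by split=> //; rewrite mulr0 oppr0 expR0; ring.
Qed.

(** Monotonicity of [G] provides measurability, and the exponential kernel dominates. [u] is kept
    apart from the endpoint [t] because [cdf_aux_like] also integrates [G (y - s)] over [[0, x]]. *)
Lemma kernel_integrable (h t u : R) (G : R -> R) : nondecreasing_fun G ->
  (forall x, 0 <= G x <= 1) ->
  mu.-integrable `[0, t] (EFin \o (fun s => h * expR (- (h * s)) * G (u - s))).
Proof.
move=> ndG G01; have [t0|t0] := leP 0 t; last first.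
  by rewrite set_itv_ge ?bnd_simp -?ltNge//; exact: integrable_set0.
apply: (@le_integrable _ _ _ mu _ _ _ (EFin \o (fun s => h * expR (- (h * s))))) => //.
- apply/measurable_EFinP; apply: measurable_funM.
    apply: measurable_funM => //; apply: measurableT_comp => //.
    by apply: measurableT_comp => //; exact: measurable_funM.
  apply: nonincreasing_measurable => // x y xy; apply: ndG.
  by rewrite lerD2l lerN2.
- move=> x _ /=; rewrite lee_fin normrM ler_piMr//.
  by have /andP[g0 g1] := G01 (u - x); rewrite ger0_norm.
- by have [] := exp_kernel_integral h t0.
Qed.

Definition cdf_like (F : R -> R) :=
  nondecreasing_fun F /\ forall t, 0 <= F t <= 1.

Lemma jump_cdf_like fuel m : (1 < m)%N -> (forall i, cdf_like (cdf_aux fuel i)) ->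
  cdf_like (jump_cdf fuel m).
Proof.
move=> m1 IH; have h0 := hold_rate_gt0 m1.
have p0 i : 0 <= rate R m i / hold_rate R m.
  by rewrite mulr_ge0 ?rate_ge0// invr_ge0 ltW.
split=> [x y xy|t].
  by apply: ler_sum => i _; rewrite ler_wpM2l//; have [nd _] := IH i; exact: nd.
apply/andP; split.
  by apply: sumr_ge0 => i _; rewrite mulr_ge0//; have [_ /(_ t)/andP[]] := IH i.
rewrite -(sum_jump_prob m1); apply: ler_sum => i _; rewrite ler_piMr//.
by have [_ /(_ t)/andP[]] := IH i.
Qed.

Lemma cdf_aux_like fuel m : cdf_like (cdf_aux fuel m).
Proof.
have base : cdf_like (fun t : R => if 0 <= t then 1 else 0 : R).
  split=> [x y xy|t]; last by case: ifP => _; rewrite ?lexx ler01.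
  case: ifPn => x0; last by case: ifP.
  by rewrite (le_trans x0 xy).
elim: fuel m => [|fuel IH] m //.
have [m1|m1] := leqP m 1.
  have -> : @cdf_aux R fuel.+1 m = fun t : R => if 0 <= t then 1 else 0.
    by apply/funext => t; rewrite cdf_aux_le1.
  exact: base.
set h := hold_rate R m; have h0 : 0 < h by exact: hold_rate_gt0.
have [ndG G01] := jump_cdf_like m1 IH.
have k0 s : 0 <= h * expR (- (h * s)) by rewrite mulr_ge0 ?expR_ge0// ltW.
split=> [x y xy|t]; last first.
  rewrite cdf_auxS// -/h; apply/andP; split.
    apply: Rintegral_ge0 => s _; rewrite mulr_ge0//.
    by have /andP[] := G01 (t - s).
  have [t0|t0] := leP 0 t; last first.
    by rewrite set_itv_ge ?bnd_simp -?ltNge// Rintegral_set0.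
  have [ki kE] := exp_kernel_integral h t0.
  apply: le_trans (_ : \int[mu]_(s in `[0, t]) (h * expR (- (h * s))) <= _).
    apply: le_Rintegral => //; first exact: kernel_integrable.
    by move=> s _; rewrite ler_piMr//; have /andP[] := G01 (t - s).
  by rewrite kE gerBl expR_ge0.
rewrite !cdf_auxS// -/h.
(* First the time inside the integrand grows from [x] to [y], then the interval does. *)
apply: le_trans (_ : \int[mu]_(s in `[0, x]) (h * expR (- (h * s)) *
    jump_cdf fuel m (y - s)) <= _).
  apply: le_Rintegral => //; [exact: kernel_integrable|exact: kernel_integrable|].
  by move=> s _; rewrite ler_wpM2l// ndG// lerD2r.
have int z := kernel_integrable h z y ndG G01.
rewrite /Rintegral fine_le//; [exact: integrable_fin_num (int x)|exact: integrable_fin_num (int y)|].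
apply: ge0_subset_integral => //; first by have /integrableP[] := int y.
  move=> s _ /=; rewrite lee_fin mulr_ge0//.
  by have /andP[] := G01 (y - s).
by move=> s; rewrite /= !in_itv/= => /andP[-> sx]/=; exact: le_trans sx xy.
Qed.

(* The maximum principle for the backward equation [v_t = L v], where
   [(L v) m = \sum_i rate m i * (v i - v m)]; used with [c = 1] and [c = -1]. *)
Lemma comparison (c : R) (v dv : nat -> R -> R) :
  (forall t : R, 0 <= t -> c <= v 1%N t) ->
  (forall m, (1 < m)%N -> 0 <= v m 0) ->
  (forall m (t : R), (1 < m)%N -> 0 <= t -> is_derive t 1 (v m) (dv m t)) ->
  (forall m (t : R), (1 < m)%N -> 0 <= t -> {for t, continuous (dv m)}) ->
  (forall m (t : R), (1 < m)%N -> 0 <= t ->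
     \sum_(1 <= i < m) rate R m i * (v i t - v m t) <= dv m t) ->
  forall fuel m (t : R), (0 < m <= fuel)%N -> 0 <= t -> c * cdf_aux fuel m t <= v m t.
Proof.
move=> v1 v0 dvE dvc Lv; elim=> [|fuel IH] m t; first by case: m.
move=> /andP[m0 mf] t0; have [m1|m1] := leqP m 1.
  by rewrite cdf_aux_le1// t0 mulr1 (_ : m = 1%N) ?v1//; lia.
rewrite cdf_auxS//; set h := hold_rate R m.
have h0 : 0 < h by exact: hold_rate_gt0.
have [ndG G01] := jump_cdf_like m1 (cdf_aux_like fuel).
have ki := kernel_integrable h t t ndG G01.
rewrite -RintegralZl//.
(* Variation of constants: [F] is a primitive of [f], and [F t - F 0 = v m t - expR (- (h * t)) * v
   m 0 <= v m t]. By induction on [fuel] and the inequality on [dv], [f] dominates [c] times the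
   integrand of [cdf_aux]. *)
pose f s := expR (- (h * s)) * (h * v m (t - s) + dv m (t - s)).
pose F s := - (expR (- (h * s)) * v m (t - s)).
have dsub (x : R) : is_derive x 1 (fun s : R => t - s) (-1).
  by apply: is_derive_eq; ring.
have dvm (x : R) : x <= t -> is_derive x 1 (fun s => v m (t - s)) (- dv m (t - x)).
  move=> xt; have -> : - dv m (t - x) = dv m (t - x) * -1 by ring.
  apply: (@is_derive1_comp _ (v m) (fun s => t - s)).
  by apply: dvE => //; rewrite subr_ge0.
have [|x /andP[x0 xt]|fi fE] := @Rintegral_FTC2 f F 0 t t0.
- move=> x /andP[x0 xt]; rewrite /F.
  have ? := dvm x xt; have ? := is_derive_expNM h x.
  by apply: is_derive_eq; rewrite /GRing.scale/= /f; ring.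
- apply: cvgM; first exact: (is_derive_continuous (is_derive_expNM h x)).
  apply: cvgD; first by apply: cvgMr; exact: (is_derive_continuous (dvm x xt)).
  apply: (@continuous_comp _ _ _ (fun s => t - s) (dv m)).
    exact: is_derive_continuous (dsub x).
  by apply: dvc => //; rewrite subr_ge0.
- apply: le_trans (_ : \int[mu]_(s in `[0, t]) f s <= _); last first.
    rewrite fE /F subrr subr0 mulr0 oppr0 expR0 mul1r opprK addrC gerBl.
    by rewrite mulr_ge0 ?expR_ge0 ?v0.
  apply: le_Rintegral => //.
    exact: (integrableZl _ _ ki).
  move=> s; rewrite /= in_itv/= => /andP[s0 st]; rewrite /f.
  rewrite [leLHS](_ : _ = expR (- (h * s)) * (c * (h * jump_cdf fuel m (t - s)))); last by ring.
  rewrite ler_wpM2l ?expR_ge0//.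
  have ts : 0 <= t - s by rewrite subr_ge0.
  apply: le_trans (_ : \sum_(1 <= i < m) rate R m i * v i (t - s) <= _).
    rewrite /jump_cdf !mulr_sumr; apply: ler_sum_nat => i /andP[i0 im].
    rewrite -/h [leLHS](_ : _ = rate R m i * (c * cdf_aux fuel i (t - s))); last first.
      by field; rewrite gt_eqF.
    rewrite ler_wpM2l ?rate_ge0//; apply: IH => //.
    by rewrite i0/= -ltnS (leq_trans im).
  have := Lv m (t - s) m1 ts; under eq_bigr do rewrite mulrBr.
  by rewrite sumrB -mulr_suml -/(hold_rate R m) -/h; lra.
Qed.

End Comparison.

(** * The normal distribution function *)

Section NormalCdf.
Variables (R : realType) (sigma : R).
Hypothesis sigma_neq0 : sigma != 0.
Local Notation P := (normal_prob 0 sigma).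

Definition Phi (x : R) : R := fine (P `]-oo, x]).

Definition phi (x : R) : R := normal_pdf 0 sigma x.

Definition phi1 (x : R) : R := - (x / sigma ^+ 2) * phi x.

Definition phi2 (x : R) : R := ((x / sigma ^+ 2) ^+ 2 - (sigma ^+ 2)^-1) * phi x.

Lemma PhiE x : (Phi x)%:E = P `]-oo, x].
Proof. by rewrite /Phi fineK// fin_num_measure. Qed.

Lemma Phi_ge0 x : 0 <= Phi x.
Proof. by rewrite -lee_fin PhiE. Qed.

Lemma Phi_le1 x : Phi x <= 1.
Proof. by rewrite -lee_fin PhiE probability_le1. Qed.

Lemma Phi_mono : nondecreasing_fun Phi.
Proof.
move=> x y xy; rewrite -lee_fin !PhiE le_measure ?inE//.
by apply: subitvPr; rewrite bnd_simp.
Qed.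

Lemma Phi_ub (e : R) : 0 < e -> exists2 A : R, 0 < A & 1 - e <= Phi A.
Proof.
move=> e0.
have c : P `]-oo, n%:R] @[n --> \oo] --> (1%:E : \bar R).
  rewrite -(@probability_setT _ _ _ P).
  have <- : \bigcup_n `]-oo, (n%:R : R)]%classic = setT.
    rewrite -subTset => t _ /=; exists (Num.truncn t).+1 => //=.
    by rewrite in_itv/= ltW// truncnS_gt.
  apply: (@nondecreasing_cvg_mu _ _ _ P) => //; first exact: bigcup_measurable.
  by move=> n m nm; apply/subsetPset; apply: subset_itvl; rewrite bnd_simp ler_nat.
have {}c : Phi n%:R @[n --> \oo] --> (1 : R).
  exact: (fine_cvg c).
have /cvgrPdist_le/(_ e e0)[N _ HN] := c.
exists N.+1%:R => //; have := HN N.+1 (leqnSn N).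
by rewrite ger0_norm ?subr_ge0 ?Phi_le1//=; lra.
Qed.

Lemma Phi_lb (e : R) : 0 < e -> exists2 A : R, 0 < A & Phi (- A) <= e.
Proof.
move=> e0.
have c : P `]-oo, - n%:R] @[n --> \oo] --> (0%:E : \bar R).
  rewrite -[0%:E](measure0 P).
  have <- : \bigcap_n `]-oo, (- n%:R : R)]%classic = set0.
    rewrite -subset0 => t /(_ (Num.truncn (- t)).+1 I) /=.
    by rewrite in_itv/= leNgt => /negP; apply; rewrite ltrNl truncnS_gt.
  apply: (@nonincreasing_cvg_mu _ _ _ P) => //.
  - by rewrite (le_lt_trans (probability_le1 _ _)) ?ltry.
  - exact: bigcap_measurable.
  - by move=> n m nm; apply/subsetPset; apply: subset_itvl; rewrite bnd_simp lerN2 ler_nat.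
have {}c : Phi (- n%:R) @[n --> \oo] --> (0 : R).
  exact: (fine_cvg c).
have /cvgrPdist_le/(_ e e0)[N _ HN] := c.
exists N.+1%:R => //; have := HN N.+1 (leqnSn N).
by rewrite sub0r normrN ger0_norm ?Phi_ge0.
Qed.

Lemma is_derive_Phi (x : R) : is_derive x 1 Phi (phi x).
Proof.
have [||||dF FE] := @continuous_FTC1 R phi -oo%O x (x + 1).
- by rewrite ltrDl.
- by apply: (integrableS _ _ (subsetT _) (integrable_normal_pdf 0 sigma)).
- exact: ltNyr.
- exact: continuous_normal_pdf.
have E : Phi = fun y : R => (\int[lebesgue_measure]_(t in `]-oo, y]) phi t)%R.
  by apply/funext => y; rewrite /Phi /normal_prob /Rintegral.
by rewrite E; apply: DeriveDef; [exact: dF|rewrite -derive1E; exact: FE].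
Qed.

Lemma phiE x : phi x = normal_peak sigma * expR (- ((2 * sigma ^+ 2)^-1 * x ^+ 2)).
Proof.
rewrite /phi normal_pdfE// /normal_fun subr0; congr (_ * expR _).
by rewrite mulNr mulrC mulr_natl.
Qed.

Lemma is_derive_phi (x : R) : is_derive x 1 phi (phi1 x).
Proof.
pose a := (2 * sigma ^+ 2)^-1.
have E : phi = fun y => normal_peak sigma * expR (- (a * y ^+ 2)).
  by apply/funext => y; rewrite phiE.
rewrite /phi1 E.
have ? : is_derive x 1 (fun y => expR (- (a * y ^+ 2))) (expR (- (a * x ^+ 2)) * (- (a * (2 * x)))).
  apply: (@is_derive1_comp _ expR (fun y => - (a * y ^+ 2))).
  by apply: is_derive_eq; rewrite /GRing.scale/=; ring.
by apply: is_derive_eq; rewrite /GRing.scale/= /a; field.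
Qed.

Lemma is_derive_phi1 (x : R) : is_derive x 1 phi1 (phi2 x).
Proof.
have ? := is_derive_phi x.
by apply: is_derive_eq; rewrite /GRing.scale/= /phi1 /phi2; field.
Qed.

(** [u * expR (- u) <= 1] at [u = x ^ 2 / (2 * sigma ^ 2)] bounds [x ^ 2 * phi x]; then
    [|x| <= 1 + x ^ 2] takes care of [phi1]. *)
Lemma phi_bounds : exists2 K : R, 0 <= K & forall x,
  [/\ `|phi x| <= K, `|phi1 x| <= K & `|phi2 x| <= K].
Proof.
pose k := normal_peak sigma; pose w := sigma ^+ 2.
have k0 : 0 <= k by exact: normal_peak_ge0.
have w0 : 0 < w by rewrite exprn_even_gt0.
have ph0 x : 0 <= phi x by exact: normal_pdf_ge0.
have b0 x : phi x <= k by exact: normal_pdf_ub.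
have b2 x : x ^+ 2 * phi x <= 2 * w * k.
  rewrite phiE -/k -/w; set a := (2 * w)^-1.
  have a0 : 0 < a by rewrite invr_gt0 mulr_gt0.
  have : a * x ^+ 2 * expR (- (a * x ^+ 2)) <= 1.
    rewrite expRN ler_pdivrMr ?expR_gt0// mul1r.
    by apply: le_trans (expR_ge1Dx _); rewrite lerDr.
  move=> H; rewrite -(ler_pM2l a0) [leRHS](_ : _ = k * 1); last first.
    by rewrite /a; field; rewrite gt_eqF.
  rewrite [leLHS](_ : _ = k * (a * x ^+ 2 * expR (- (a * x ^+ 2)))); last by ring.
  by rewrite ler_wpM2l.
have wi : 0 < w^-1 by rewrite invr_gt0.
pose K := k + (k + 2 * w * k) / w + 2 * k / w + k / w.
have [k1 k2 k3] : [/\ 0 <= (k + 2 * w * k) / w, 0 <= 2 * k / w & 0 <= k / w].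
  have w1 := ltW w0.
  by split; apply: divr_ge0 => //; nra.
exists K => [|x]; first by rewrite /K; lra.
split.
- by rewrite ger0_norm// /K; have := b0 x; lra.
- rewrite /phi1 normrM normrN normrM (ger0_norm (ph0 x)) -/w (ger0_norm (ltW wi)).
  have : `|x| * phi x <= k + 2 * w * k.
    apply: le_trans (_ : (1 + x ^+ 2) * phi x <= _); last first.
      by rewrite mulrDl mul1r lerD.
    rewrite ler_wpM2r// -real_normK ?num_real//.
    have [x1|x1] := leP `|x| 1; first by rewrite (le_trans x1)// lerDl exprn_ge0.
    by rewrite (le_trans (_ : _ <= `|x| ^+ 2))// ?lerDr// expr2 ler_peMr// ltW.
  move=> H; rewrite mulrAC; apply: le_trans (_ : (k + 2 * w * k) / w <= _).
    by rewrite ler_wpM2r// ltW.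
  by rewrite /K; lra.
- rewrite /phi2 -/w.
  have -> : ((x / w) ^+ 2 - w^-1) * phi x = x ^+ 2 * phi x / w / w - phi x / w.
    by field; rewrite gt_eqF.
  apply: le_trans (ler_normB _ _) _; rewrite !ger0_norm; last 2 first.
  + by rewrite divr_ge0// ltW.
  + by have w1 := ltW w0; rewrite !divr_ge0// mulr_ge0// sqr_ge0.
  have : x ^+ 2 * phi x / w / w <= 2 * k / w.
    rewrite ler_wpM2r ?(ltW wi)// ler_pdivrMr//.
    by apply: le_trans (b2 x) _; rewrite mulrAC.
  have : phi x / w <= k / w by rewrite ler_wpM2r// ltW.
  by rewrite /K; lra.
Qed.
End NormalCdf.

(** * Second-order Taylor expansion with cubic remainder *)

Section Taylor.
Variable R : realType.

(** The mean value theorem is applied three times, to the remainders of [f2], [f1] and [f] in turn;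
    this gives up the factor [1 / 6]. *)
Lemma taylor2_remainder (f f1 f2 f3 : R -> R) (K x d : R) :
  (forall y : R, is_derive y 1 f (f1 y)) -> (forall y : R, is_derive y 1 f1 (f2 y)) ->
  (forall y : R, is_derive y 1 f2 (f3 y)) -> (forall y, `|f3 y| <= K) -> 0 <= d ->
  `|f (x + d) - f x - (f1 x * d + f2 x * d ^+ 2 / 2)| <= K * d ^+ 3.
Proof.
move=> df df1 df2 f3K d0.
have K0 : 0 <= K by apply: le_trans (f3K 0).
have shift (g dg : R -> R) (y : R) : (forall z : R, is_derive z 1 g (dg z)) ->
    is_derive y 1 (fun u => g (x + u)) (dg (x + y)).
  move=> gd; rewrite -[dg _]mulr1.
  apply: (@is_derive1_comp _ g (fun u => x + u)).
  rewrite -[1 in X in is_derive _ _ _ X]add0r.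
  exact: (@is_deriveD _ _ _ (cst x) id).
have r2 u : 0 <= u -> `|f2 (x + u) - f2 x| <= K * u.
  move=> u0; have [c _] := mvt_segment u0 (fun y _ => shift _ _ y df2).
  by rewrite addr0 subr0 => ->; rewrite normrM (ger0_norm u0) ler_wpM2r.
have r1 u : 0 <= u -> `|f1 (x + u) - f1 x - f2 x * u| <= K * u ^+ 2.
  move=> u0.
  have D (y : R) : is_derive y 1 (fun u => f1 (x + u) - f2 x * u) (f2 (x + y) - f2 x).
    have ? := shift _ _ y df1.
    by apply: is_derive_eq; rewrite /GRing.scale/=; ring.
  have [c /andP[c0 cu]] := mvt_segment u0 (fun y _ => D y).
  rewrite addr0 !mulr0 !subr0 addrAC => ->.
  rewrite normrM (ger0_norm u0) expr2 mulrA ler_wpM2r//.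
  by apply: le_trans (r2 _ c0) _; rewrite ler_wpM2l.
have D (y : R) : is_derive y 1 (fun u => f (x + u) - (f1 x * u + f2 x * u ^+ 2 / 2))
    (f1 (x + y) - f1 x - f2 x * y).
  have ? := shift _ _ y df.
  by apply: is_derive_eq; rewrite /GRing.scale/=; field.
have [c /andP[c0 cu]] := mvt_segment d0 (fun y _ => D y).
rewrite addr0 !mulr0 expr0n mulr0 mul0r addr0 !subr0 addrAC => ->.
rewrite normrM (ger0_norm d0) exprSr mulrA ler_wpM2r//.
apply: le_trans (r1 _ c0) _; rewrite ler_wpM2l// lerXn2r ?nnegrE//.
Qed.

End Taylor.

(** * Gaussian barriers *)

Section Barrier.
Variables (R : realType) (sigma : R).
Local Notation z2 := (zeta R 2).
Local Notation z3 := (zeta R 3).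
Hypothesis sigma_neq0 : sigma != 0.
Hypothesis sigmaE : sigma ^+ 2 = 2 * z3 / z2 ^+ 3.

(** [z2 ^ 3 * t] is the variance [2 * z3 * t] divided by [sigma ^ 2], which [Phi sigma] already
    carries; [b > 0] keeps the scale positive at time 0. *)
Definition spread (b t : R) : R := Num.sqrt (z2 ^+ 3 * t + b).

Definition score (b s : R) (m : nat) (t : R) : R :=
  (z2 * t - harm R m + s) / spread b t.

Definition front (b s : R) (m : nat) (t : R) : R := Phi sigma (score b s m t).

(** The limiting generator [- z2 * d/dh + z3 * d^2/dh^2] applied to the profile [front], with
    [h = harm m]. *)
Definition dfront (b s : R) (m : nat) (t : R) : R :=
  z2 * phi sigma (score b s m t) / spread b t +
  z3 * phi1 sigma (score b s m t) / spread b t ^+ 2.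

Lemma zeta2_gt0 : 0 < z2.
Proof. by rewrite (lt_le_trans ltr01)// zeta_ge1. Qed.

Lemma spread_arg_gt0 (b t : R) : 0 < b -> 0 <= t -> 0 < z2 ^+ 3 * t + b.
Proof. by move=> b0 t0; rewrite ltr_wpDl// mulr_ge0// exprn_ge0// ltW// zeta2_gt0. Qed.

Lemma spread_gt0 (b t : R) : 0 < b -> 0 <= t -> 0 < spread b t.
Proof. by move=> b0 t0; rewrite sqrtr_gt0 spread_arg_gt0. Qed.

Lemma is_derive_spread (b t : R) : 0 < b -> 0 <= t ->
  is_derive t 1 (spread b) (z2 ^+ 3 / (2 * spread b t)).
Proof.
move=> b0 t0; rewrite mulrC; have p0 := spread_arg_gt0 b0 t0.
apply: (@is_derive1_comp _ Num.sqrt (fun t => z2 ^+ 3 * t + b)).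
  exact: is_derive1_sqrt.
by apply: is_derive_eq; rewrite /GRing.scale/=; ring.
Qed.

Lemma is_derive_score (b s : R) m (t : R) : 0 < b -> 0 <= t ->
  is_derive t 1 (score b s m)
    (z2 / spread b t - z2 ^+ 3 * score b s m t / (2 * spread b t ^+ 2)).
Proof.
move=> b0 t0; have r0 : spread b t != 0 by rewrite gt_eqF// spread_gt0.
have ? := is_derive_spread b0 t0.
have ? := is_deriveV r0 (is_derive_spread b0 t0).
by apply: is_derive_eq; rewrite /GRing.scale/= /score; field.
Qed.

(** The profile solves the limiting equation exactly because [sigmaE] means
    [z3 / sigma ^ 2 = z2 ^ 3 / 2]; this is what fixes the value of [sigma]. *)
Lemma is_derive_front (b s : R) m (t : R) : 0 < b -> 0 <= t ->
  is_derive t 1 (front b s m) (dfront b s m t).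
Proof.
move=> b0 t0; have r0 : spread b t != 0 by rewrite gt_eqF// spread_gt0.
have z0 : z2 != 0 by rewrite gt_eqF// zeta2_gt0.
have z30 : z3 != 0 by rewrite gt_eqF// (lt_le_trans ltr01)// zeta_ge1.
have -> : dfront b s m t = phi sigma (score b s m t) *
    (z2 / spread b t - z2 ^+ 3 * score b s m t / (2 * spread b t ^+ 2)).
  rewrite /dfront /phi1 sigmaE; field; by rewrite r0 z0 z30.
apply: (@is_derive1_comp _ (Phi sigma) (score b s m)).
  exact: is_derive_Phi.
exact: is_derive_score.
Qed.

Lemma continuous_dfront (b s : R) m (t : R) : 0 < b -> 0 <= t ->
  {for t, continuous (dfront b s m)}.
Proof.
move=> b0 t0; have r0 : spread b t != 0 by rewrite gt_eqF// spread_gt0.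
have cs := is_derive_continuous (is_derive_score s m b0 t0).
have cr := is_derive_continuous (is_derive_spread b0 t0).
have comp (f df : R -> R) : (forall x : R, is_derive x 1 f (df x)) ->
    {for t, continuous (fun u => f (score b s m u))}.
  move=> fd; apply: (@continuous_comp _ _ _ (score b s m) f) => //.
  exact: is_derive_continuous (fd _).
apply: cvgD; (apply: cvgM; [apply: cvgMr|]).
- exact: (comp _ _ (is_derive_phi sigma_neq0)).
- exact: cvgV.
- exact: (comp _ _ (is_derive_phi1 sigma_neq0)).
- apply: cvgV; first by rewrite expf_neq0.
  apply: (@continuous_comp _ _ _ (spread b) (fun x => x ^+ 2)) => //.
  exact: exprn_continuous.
Qed.

(* [Phi] is expanded to second order in the jump of [harm]; the first two
   moments are [jump_moment 1] and [jump_moment 2]. *)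
Lemma front_generator K (b s : R) m (t : R) : 0 < b -> 0 <= t -> (0 < m)%N ->
  (forall x, `|phi2 sigma x| <= K) ->
  `|\sum_(1 <= i < m) rate R m i * (front b s i t - front b s m t) -
    (phi sigma (score b s m t) * (zeta_sum R 2 m / spread b t) +
     phi1 sigma (score b s m t) * (jump_moment R 2 m / spread b t ^+ 2 / 2))| <=
  61 * K / spread b t ^+ 3.
Proof.
move=> b0 t0 m0 K2; set r := spread b t; set w := score b s m t.
have r0 : 0 < r by exact: spread_gt0.
have K0 : 0 <= K by apply: le_trans (K2 0).
rewrite -jump_moment1E// /jump_moment !mulr_suml !mulr_sumr -big_split/= -sumrB.
apply: le_trans (ler_norm_sum _ _ _) _.
apply: le_trans (_ : \sum_(1 <= i < m) rate R m i *
  (K * ((harm R m - harm R i) / r) ^+ 3) <= _).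
  apply: ler_sum_nat => i /andP[i0 im].
  set d := (harm R m - harm R i) / r.
  have d0 : 0 <= d by rewrite divr_ge0 ?(ltW r0)// subr_ge0 le_harm// ltnW.
  have -> : front b s i t = Phi sigma (w + d).
    by rewrite /front; congr (Phi _ _); rewrite /w /d /score -/r; field; rewrite gt_eqF.
  rewrite -/(front b s m t) {1}/front -/w.
  have := taylor2_remainder w (is_derive_Phi sigma_neq0) (is_derive_phi sigma_neq0)
    (is_derive_phi1 sigma_neq0) K2 d0.
  set A := `|_| => HA.
  rewrite [X in `|X|](_ : _ = rate R m i * (Phi sigma (w + d) - Phi sigma w -
    (phi sigma w * d + phi1 sigma w * d ^+ 2 / 2))); last first.
    by rewrite /d; field; rewrite gt_eqF.
  by rewrite normrM (ger0_norm (rate_ge0 R m i)) ler_wpM2l ?rate_ge0.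
rewrite [leLHS](_ : _ = K / r ^+ 3 * jump_moment R 3 m); last first.
  rewrite /jump_moment mulr_sumr; apply: eq_bigr => i _; field; rewrite gt_eqF//.
rewrite [leRHS](_ : _ = K / r ^+ 3 * 61); last by field; rewrite gt_eqF.
by rewrite ler_wpM2l ?jump_moment3_le// divr_ge0// exprn_ge0// ltW.
Qed.

Lemma harm_generator m : (0 < m)%N ->
  \sum_(1 <= i < m) rate R m i * (harm R i - harm R m) = - zeta_sum R 2 m.
Proof.
move=> m0; apply/eqP; rewrite -addr_eq0 -jump_moment1E// /jump_moment -big_split/=.
by rewrite big1// => i _; rewrite expr1 -mulrDr addrA subrK subrr mulr0.
Qed.

(** Termwise, [(1 / m - 1 / i) / (m - i) = - 1 / (m i)]. *)
Lemma inv_generator m : (0 < m)%N ->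
  \sum_(1 <= i < m) rate R m i * ((1 - i%:R^-1) - (1 - m%:R^-1)) = - (harm R m / m%:R).
Proof.
move=> m0; rewrite /harm mulr_suml -sumrN; apply: eq_big_nat => i /andP[i0 im].
rewrite /rate natrB ?(ltnW im)//.
have : (m%:R - i%:R : R) != 0 by rewrite -natrB ?(ltnW im)// pnatr_eq0 subn_eq0 -ltnNge.
have : (m%:R : R) != 0 by rewrite pnatr_eq0 -lt0n.
have : (i%:R : R) != 0 by rewrite pnatr_eq0 -lt0n.
by move=> ? ? ?; field; exact/and3P.
Qed.

(* The error terms of [front_generator] are absorbed by adding
   [k1 * harm m + k2 * (1 - 1 / m)], whose images under the generator are at
   most [- k1] and [- k2 / m]. *)
Lemma barrier (K c s beta eta k1 k2 e C : R) :
  (forall x, [/\ `|phi sigma x| <= K, `|phi1 sigma x| <= K & `|phi2 sigma x| <= K]) ->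
  `|c| = 1 -> 0 < beta -> 0 <= eta -> 0 <= e -> 0 <= C ->
  (forall m, (0 < m)%N -> `|z3 - jump_moment R 2 m / 2| <= e + C / m%:R) ->
  K * e / beta ^+ 2 + 61 * K / beta ^+ 3 <= k1 ->
  2 * K / beta + K * C / beta ^+ 2 <= k2 ->
  (forall t, 0 <= t -> c <= c * front (beta ^+ 2) s 1 t + eta) ->
  (forall m, (1 < m)%N -> 0 <= c * front (beta ^+ 2) s m 0 + eta) ->
  forall n t, (0 < n)%N -> 0 <= t ->
  c * D_cdf n t <= c * front (beta ^+ 2) s n t + eta + k1 * harm R n + k2.
Proof.
move=> HK c1 beta0 eta0 e0 C0 T2 Hk1 Hk2 H1 H0 n t n0 t0.
have K0 : 0 <= K by have [] := HK 0; move=> /(le_trans _) + _ _; apply.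
have b2 : 0 < beta ^+ 2 by rewrite exprn_gt0.
have b3 : 0 < beta ^+ 3 by rewrite exprn_gt0.
have k10 : 0 <= k1.
  by apply: le_trans Hk1; rewrite addr_ge0 ?divr_ge0 ?mulr_ge0// ltW.
have k20 : 0 <= k2.
  by apply: le_trans Hk2; rewrite addr_ge0 ?divr_ge0 ?mulr_ge0// ltW.
set b := beta ^+ 2 in H1 H0 b2 *.
have inv1 m : (0 < m)%N -> (0 : R) <= 1 - m%:R^-1 <= (1 : R).
  move=> m0; rewrite subr_ge0 gerBl invr_ge0 ler0n andbT.
  by rewrite invf_le1 ?ltr0n// ler1n.
(* Both correctors vanish at [m = 1], leaving the boundary condition there untouched, and the second
   never exceeds [k2]. *)
pose v m t := c * front b s m t + (eta + k1 * harm R m + k2 * (1 - m%:R^-1)).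
pose dv m t := c * dfront b s m t.
apply: le_trans (_ : v n t <= _); last first.
  rewrite /v !addrA lerD2l ler_piMr//.
apply: (@comparison R c v dv) => //.
- by move=> u u0; rewrite /v harm1 invr1 subrr !mulr0 !addr0; exact: H1.
- move=> m m1; rewrite /v !addrA; have := H0 m m1.
  have : 0 <= k1 * harm R m by rewrite mulr_ge0// harm_ge0.
  have : 0 <= k2 * (1 - m%:R^-1).
    by rewrite mulr_ge0//; have /andP[] := inv1 m (ltnW m1).
  lra.
- move=> m u m1 u0; have ? := is_derive_front s m b2 u0.
  by apply: is_derive_eq; rewrite /GRing.scale/= /dv; ring.
- move=> m u m1 u0; apply: cvgMr; exact: continuous_dfront.
- move=> m u m1 u0; have m0 := ltnW m1.
  set r := spread b u; have r0 : 0 < r by exact: spread_gt0.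
  have rb : beta <= r.
    rewrite -[leLHS](ger0_norm (ltW beta0)) -sqrtr_sqr ler_wsqrtr// lerDr.
    by rewrite mulr_ge0// exprn_ge0// ltW// zeta2_gt0.
  have -> : \sum_(1 <= i < m) rate R m i * (v i u - v m u) =
    c * (\sum_(1 <= i < m) rate R m i * (front b s i u - front b s m u)) -
    (k1 * zeta_sum R 2 m + k2 * (harm R m / m%:R)).
    have -> : - (k1 * zeta_sum R 2 m + k2 * (harm R m / m%:R)) =
        k1 * (- zeta_sum R 2 m) + k2 * (- (harm R m / m%:R)) by ring.
    rewrite -harm_generator// -inv_generator//.
    rewrite !mulr_sumr -!big_split/=; apply: eq_bigr => i _; rewrite /v; ring.
  have [p0 p1 _] := HK (score b s m u).
  have K2 x : `|phi2 sigma x| <= K by have [] := HK x.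
  have G := front_generator s b2 u0 m0 K2.
  rewrite -/r in G; rewrite /dv /dfront -/r.
  set p := phi sigma _ in p0 G *; set q := phi1 sigma _ in p1 G *.
  set S := \sum_(1 <= i < m) _ in G *.
  have h1 : 1 <= zeta_sum R 2 m.
    have := @zeta_sum_nd R 2 2 m m1; rewrite [leLHS]/zeta_sum big_nat1.
    by rewrite expr1n invr1.
  have h2 := @harm_ge1 R m m1.
  have h3 : `|z2 - zeta_sum R 2 m| <= 2 / m%:R.
    rewrite ger0_norm ?subr_ge0 ?zeta_sum_le//.
    by have := @zeta2_le R m m1; lra.
  have mi : 0 < m%:R^-1 :> R by rewrite invr_gt0 ltr0n.
  (* Three errors: drift ([A1], of order [1 / m]), variance ([A2], of the form [e + C / m]) and
     Taylor remainder ([A3]). The constant parts go into [k1], the multiples of [1 / m] into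
     [k2]. *)
  have D : `|z2 * p / r + z3 * q / r ^+ 2 - S| <= k1 + k2 / m%:R.
    rewrite (_ : _ - S = p * (z2 - zeta_sum R 2 m) / r +
      q * (z3 - jump_moment R 2 m / 2) / r ^+ 2 -
      (S - (p * (zeta_sum R 2 m / r) + q * (jump_moment R 2 m / r ^+ 2 / 2)))); last first.
      by field; rewrite gt_eqF.
    apply: le_trans (ler_normB _ _) _.
    apply: le_trans (lerD (ler_normD _ _) G) _.
    have A1 : `|p * (z2 - zeta_sum R 2 m) / r| <= K * (2 / m%:R) / beta.
      rewrite (normrM (p * _)) (normrM p) normfV (gtr0_norm r0).
      rewrite ler_pM ?mulr_ge0 ?invr_ge0 ?(ltW r0)//.
        by rewrite ler_pM.
      by rewrite lef_pV2 ?posrE.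
    have A2 : `|q * (z3 - jump_moment R 2 m / 2) / r ^+ 2| <= K * (e + C / m%:R) / b.
      rewrite (normrM (q * _)) (normrM q) normfV (gtr0_norm (exprn_gt0 2 r0)).
      rewrite ler_pM ?mulr_ge0 ?invr_ge0 ?exprn_ge0 ?(ltW r0)//.
        by rewrite ler_pM// T2.
      by rewrite lef_pV2 ?posrE ?exprn_gt0// /b lerXn2r ?nnegrE ?(ltW r0) ?(ltW beta0).
    have A3 : 61 * K / r ^+ 3 <= 61 * K / beta ^+ 3.
      rewrite ler_wpM2l ?mulr_ge0// lef_pV2 ?posrE ?exprn_gt0//.
      by rewrite lerXn2r ?nnegrE ?(ltW r0) ?(ltW beta0).
    have A4 : (2 * K / beta + K * C / b) / m%:R <= k2 / m%:R.
      by rewrite ler_wpM2r// ltW.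
    have E1 : K * (2 / m%:R) / beta = 2 * K / beta / m%:R by ring.
    have E2 : K * (e + C / m%:R) / b = K * e / b + K * C / b / m%:R by ring.
    rewrite E1 in A1; rewrite E2 in A2; rewrite mulrDl in A4; rewrite -/b in Hk1.
    lra.
  have cD : c * S - c * (z2 * p / r + z3 * q / r ^+ 2) <= k1 + k2 / m%:R.
    rewrite -mulrBr (le_trans (ler_norm _))// normrM c1 mul1r distrC.
    exact: D.
  have B1 : k1 * 1 <= k1 * zeta_sum R 2 m by rewrite ler_wpM2l.
  have B2 : k2 * (1 / m%:R) <= k2 * (harm R m / m%:R).
    by rewrite ler_wpM2l// ler_wpM2r// ltW.
  rewrite mulr1 in B1; rewrite mul1r in B2.
  lra.
- by rewrite n0 leqnn.
Qed.

End Barrier.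

(** * The limit *)

Section Limit.
Variables (R : realType) (sigma : R).
Local Notation z2 := (zeta R 2).
Local Notation z3 := (zeta R 3).
Hypothesis sigma_neq0 : sigma != 0.
Hypothesis sigmaE : sigma ^+ 2 = 2 * z3 / z2 ^+ 3.

Lemma Phi_tails (e : R) : 0 < e -> exists2 A : R, 0 < A &
  1 - e <= Phi sigma A /\ Phi sigma (- A) <= e.
Proof.
move=> e0; have [A A0 HA] := Phi_ub sigma e0; have [B B0 HB] := Phi_lb sigma e0.
exists (Num.max A B); first by rewrite lt_max A0.
split.
- by apply: le_trans HA (Phi_mono _ _); rewrite le_max lexx.
- by apply: le_trans (Phi_mono _ _) HB; rewrite lerN2 le_max lexx orbT.
Qed.

(** For [c = 1] the score must be at least [A]. After squaring, this amounts to [(z2 t / A) ^ 2 +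
    (z2 t / A) (2 beta - A z2 ^ 2) >= 0], whence the lower bound imposed on [beta]. For [c = -1],
    [Phi <= 1] is enough. *)
Lemma front_boundary1 (c A beta eta t : R) : c = 1 \/ c = -1 ->
  0 < A -> 0 < beta -> A * z2 ^+ 2 <= 2 * beta -> 0 <= eta ->
  1 - eta <= Phi sigma A -> 0 <= t ->
  c <= c * front sigma (beta ^+ 2) (c * A * beta) 1 t + eta.
Proof.
have z0 := zeta2_gt0 R.
move=> [->|->] A0 beta0 Ab eta0 HA t0; last first.
  have := Phi_le1 sigma (score (beta ^+ 2) (-1 * A * beta) 1 t).
  by rewrite /front mulN1r; lra.
rewrite !mul1r -lerBlDr; apply: le_trans HA (Phi_mono _ _).
rewrite /score harm1 subr0 ler_pdivlMr ?spread_gt0 ?exprn_gt0//.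
rewrite -ler_pdivlMl// /spread.
have Y0 : 0 <= A^-1 * (z2 * t + A * beta).
  by rewrite mulr_ge0 ?invr_ge0 ?addr_ge0 ?mulr_ge0// ltW.
rewrite -[leRHS](ger0_norm Y0) -sqrtr_sqr ler_wsqrtr// -subr_ge0.
rewrite [leRHS](_ : _ = (z2 * t / A) ^+ 2 + z2 * t / A * (2 * beta - A * z2 ^+ 2)).
  by rewrite addr_ge0 ?sqr_ge0// mulr_ge0 ?subr_ge0// !mulr_ge0 ?invr_ge0// ltW.
by field; rewrite gt_eqF.
Qed.

(** At time 0 the spread is [beta], so for [c = -1] the shift [- A * beta] puts the score below
    [- A]. For [c = 1], [Phi >= 0] is enough. *)
Lemma front_boundary0 (c A beta eta : R) m : c = 1 \/ c = -1 ->
  0 < A -> 0 < beta -> 0 <= eta -> Phi sigma (- A) <= eta ->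
  0 <= c * front sigma (beta ^+ 2) (c * A * beta) m 0 + eta.
Proof.
move=> [->|->] A0 beta0 eta0 HA.
  by rewrite mul1r addr_ge0// Phi_ge0.
rewrite mulN1r addrC subr_ge0; apply: le_trans (Phi_mono _ _) HA.
rewrite /score /spread !mulr0 !add0r sqrtr_sqr (ger0_norm (ltW beta0)).
rewrite ler_pdivrMr// mulN1r mulNr gerDr lerNl oppr0; exact: harm_ge0.
Qed.

Lemma Phi_quotient_cvg (T : Type) (F : set_system T) (FF : ProperFilter F)
    (a b : T -> R) (a0 b0 : R) : a @ F --> a0 -> b @ F --> b0 -> 0 < b0 ->
  Phi sigma (a x / Num.sqrt (b x)) @[x --> F] --> Phi sigma (a0 / Num.sqrt b0).
Proof.
move=> ca cb b00; apply: (@continuous_cvg _ _ _ F FF _ (Phi sigma)).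
  exact: (is_derive_continuous (is_derive_Phi sigma_neq0 _)).
apply: cvgM => //; apply: cvgV; first by rewrite gt_eqF// sqrtr_gt0.
apply: (@continuous_cvg _ _ _ F FF _ Num.sqrt) => //; exact: sqrt_continuous.
Qed.

(** Removes the smoothing from the limit in [front_cvg]: as [d] decreases to 0 the argument of [Phi]
    tends to [z2 * x / z2 = x]. *)
Lemma small_smoothing (c A x e : R) : 0 < e -> exists2 d : R, 0 < d &
  `|Phi sigma ((z2 * x + c * A * d) / Num.sqrt (z2 ^+ 2 + d ^+ 2)) - Phi sigma x| <= e.
Proof.
move=> e0; have z0 := zeta2_gt0 R.
have : Phi sigma ((z2 * x + c * A * d) / Num.sqrt (z2 ^+ 2 + d ^+ 2)) @[d --> 0^'+] -->
    Phi sigma ((z2 * x + c * A * 0) / Num.sqrt (z2 ^+ 2 + 0 ^+ 2)).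
  apply: Phi_quotient_cvg; last by rewrite expr0n addr0 exprn_gt0.
    apply: cvg_at_right_filter; apply: cvgD; first exact: cvg_cst.
    by apply: cvgMr; exact: cvg_id.
  apply: cvg_at_right_filter; apply: cvgD; first exact: cvg_cst.
  exact: exprn_continuous.
have -> : (z2 * x + c * A * 0) / Num.sqrt (z2 ^+ 2 + 0 ^+ 2) = x.
  by rewrite mulr0 addr0 expr0n/= addr0 sqrtr_sqr (gtr0_norm z0) mulrC mulKf ?gt_eqF.
move=> /cvgrPdist_le/(_ e e0) H.
have : \forall d \near 0^'+, 0 < d /\ `|Phi sigma x -
    Phi sigma ((z2 * x + c * A * d) / Num.sqrt (z2 ^+ 2 + d ^+ 2))| <= e.
  near=> d; split; first by near: d; exact: nbhs_right_gt.
  by near: d.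
by move=> /filter_ex[d [d0 Hd]]; exists d => //; rewrite distrC.
Unshelve. all: by end_near. Qed.

Local Notation L n := (ln (n%:R : R)).
Local Notation rt n := (Num.sqrt (L n)).

Lemma cvg_sqrt_ln : rt n @[n --> \oo] --> +oo.
Proof.
apply/cvgryPge => A; near=> n.
have : A ^+ 2 <= L n.
  by near: n; move/cvgryPge : (@cvg_ln_nat R); apply.
by move=> /ler_wsqrtr; rewrite sqrtr_sqr; apply: le_trans; exact: ler_norm.
Unshelve. all: by end_near. Qed.

Lemma cvg_inv_sqrt_ln : (rt n)^-1 @[n --> \oo] --> 0.
Proof.
apply/gtr0_cvgV0; last exact: cvg_sqrt_ln.
by near=> n; rewrite sqrtr_gt0 ln_gt0// ltr1n; near: n; exact: nbhs_infty_gt.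
Unshelve. all: by end_near. Qed.

Lemma cvg_harm_error : (L n - harm R n) / rt n @[n --> \oo] --> 0.
Proof.
apply/norm_cvg0P.
apply: (@squeeze_cvgr _ _ _ _ (cst 0) (fun n => (rt n)^-1)); last 2 first.
- exact: cvg_cst.
- exact: cvg_inv_sqrt_ln.
near=> n; rewrite normr_ge0/= normrM normfV (ger0_norm (sqrtr_ge0 _)).
have n0 : (0 < n)%N by near: n; exact: nbhs_infty_gt.
rewrite ler_piMl ?invr_ge0 ?sqrtr_ge0// ler_norml.
have := @ln_le_harm R n n0; have := @harm_le_ln R n n0.
by move=> *; apply/andP; split; lra.
Unshelve. all: by end_near. Qed.

(** Numerator and spread are divided by [rt n]: [z2 * t = L n + z2 * x * rt n], where [L n] cancels
    [harm n] up to a bounded error, and the squared spread is [(z2 ^ 2 + d ^ 2) * L n] to leading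
    order. *)
Lemma front_cvg (c A d x : R) : 0 < d ->
  front sigma ((d * rt n) ^+ 2) (c * A * (d * rt n)) n (z2^-1 * L n + x * rt n)
    @[n --> \oo] -->
  Phi sigma ((z2 * x + c * A * d) / Num.sqrt (z2 ^+ 2 + d ^+ 2)).
Proof.
move=> d0; have z0 := zeta2_gt0 R.
pose a n := (L n - harm R n) / rt n + (z2 * x + c * A * d).
pose b n := z2 ^+ 3 * x * (rt n)^-1 + (z2 ^+ 2 + d ^+ 2).
have ca : a n @[n --> \oo] --> z2 * x + c * A * d.
  rewrite -[X in _ --> X]add0r; apply: cvgD; last exact: cvg_cst.
  exact: cvg_harm_error.
have cb : b n @[n --> \oo] --> z2 ^+ 2 + d ^+ 2.
  rewrite -[X in _ --> X]add0r; apply: cvgD; last exact: cvg_cst.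
  rewrite -(mulr0 (z2 ^+ 3 * x)); apply: cvgMr; exact: cvg_inv_sqrt_ln.
have := Phi_quotient_cvg _ ca cb; rewrite addr_gt0 ?exprn_gt0// => /(_ _ isT).
apply: cvg_trans; apply: near_eq_cvg; near=> n.
rewrite /front; congr (Phi _ _); rewrite /score /spread /a /b.
have l0 : 0 < L n by rewrite ln_gt0// ltr1n; near: n; exact: nbhs_infty_gt.
have r0 : 0 < rt n by rewrite sqrtr_gt0.
have r2 : rt n ^+ 2 = L n by rewrite sqr_sqrtr// ltW.
move: (rt n) r0 r2 => r r0 <-.
have -> : z2 ^+ 3 * (z2^-1 * r ^+ 2 + x * r) + (d * r) ^+ 2 =
    r ^+ 2 * (z2 ^+ 3 * x / r + (z2 ^+ 2 + d ^+ 2)).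
  by field; rewrite !gt_eqF.
rewrite sqrtrM ?exprn_ge0 ?(ltW r0)// sqrtr_sqr (gtr0_norm r0) invfM.
move: (Num.sqrt _)^-1 => w; field; by rewrite !gt_eqF.
Unshelve. all: by end_near. Qed.

(** The cost [k1 * harm n + k2] of the barrier for [beta = d * rt n], with [harm n] replaced by its
    bound [rt n ^ 2 + 1]. Only the variance error survives in the limit. *)
Lemma error_cvg (K e C d : R) :
  (K * e / d ^+ 2 + 61 * K / d ^+ 3 * (rt n)^-1) * (1 + (rt n)^-1 ^+ 2) +
   (2 * K / d * (rt n)^-1 + K * C / d ^+ 2 * (rt n)^-1 ^+ 2)
    @[n --> \oo] --> K * e / d ^+ 2.
Proof.
have u := cvg_inv_sqrt_ln.
have u2 : (rt n)^-1 ^+ 2 @[n --> \oo] --> 0.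
  by rewrite -[X in _ --> X](mulr0 0); exact: cvgM.
rewrite -[X in _ --> X]addr0; apply: cvgD.
  rewrite -[X in _ --> X]mulr1; apply: cvgM.
    rewrite -[X in _ --> X]addr0; apply: cvgD; first exact: cvg_cst.
    by rewrite -(mulr0 (61 * K / d ^+ 3)); exact: cvgMr.
  by rewrite -[X in _ --> X]addr0; apply: cvgD; first exact: cvg_cst.
rewrite -[X in _ --> X]addr0; apply: cvgD.
  by rewrite -(mulr0 (2 * K / d)); exact: cvgMr.
by rewrite -(mulr0 (K * C / d ^+ 2)); exact: cvgMr.
Qed.

(** Order of choices: [A] from the tails, [d] from [A], [e] from [d] and [K], [C] from [e], and [n]
    last. The four quarters of [eps] pay for the boundary slack, the barrier cost, the convergence
    of [front] and the smoothing. *)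
Lemma D_cdf_one_sided (c x eps : R) : c = 1 \/ c = -1 -> 0 < eps ->
  \forall n \near \oo,
    c * D_cdf n (z2^-1 * L n + x * rt n) <= c * Phi sigma x + eps.
Proof.
move=> c1 eps0; have z0 := zeta2_gt0 R; pose eta := eps / 4.
have eta0 : 0 < eta by rewrite divr_gt0.
have cn : `|c| = 1 by case: c1 => ->; rewrite ?normrN normr1.
have [A A0 [HA1 HA0]] := Phi_tails eta0.
have [d d0 Hd] := small_smoothing c A x eta0.
have [K K0 HK] := phi_bounds sigma_neq0.
(* Makes [K * e / d ^ 2] strictly smaller than [eta]; [K + 1] keeps the divisor positive. *)
pose e := d ^+ 2 * eta / 2 / (K + 1).
have K1 : 0 < K + 1 by rewrite ltr_wpDl.
have e0 : 0 < e by rewrite divr_gt0// divr_gt0// mulr_gt0// exprn_gt0.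
have Ke : K * e / d ^+ 2 < eta.
  have -> : K * e / d ^+ 2 = K / (K + 1) * (eta / 2).
    by rewrite /e; field; rewrite !gt_eqF.
  apply: le_lt_trans (_ : 1 * (eta / 2) < _); last by lra.
  rewrite ler_wpM2r// ?ler_pdivrMr//; lra.
have [C C0 HC] := jump_moment2_near e0.
have F := @front_cvg c A d x d0; have E := @error_cvg K e C d.
near=> n.
have n0 : (0 < n)%N by near: n; exact: nbhs_infty_gt.
have l0 : 0 < L n by rewrite ln_gt0// ltr1n; near: n; exact: nbhs_infty_gt.
have r0 : 0 < rt n by rewrite sqrtr_gt0.
have r2 : rt n ^+ 2 = L n by rewrite sqr_sqrtr// ltW.
(* [rA] is the condition on [beta] in [front_boundary1]; [rx] makes the time nonnegative when
   [x < 0]. *)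
have rA : A * z2 ^+ 2 / (2 * d) <= rt n.
  by near: n; move/cvgryPge : cvg_sqrt_ln; apply.
have rx : - x * z2 <= rt n.
  by near: n; move/cvgryPge : cvg_sqrt_ln; apply.
have t0 : 0 <= z2^-1 * L n + x * rt n.
  move: (rt n) r0 r2 rx => r r0 <- rx.
  have -> : z2^-1 * r ^+ 2 + x * r = z2^-1 * (r * (r + x * z2)).
    by field; rewrite gt_eqF.
  by rewrite !mulr_ge0 ?invr_ge0 ?(ltW z0) ?(ltW r0)//; lra.
have Fn : `|Phi sigma ((z2 * x + c * A * d) / Num.sqrt (z2 ^+ 2 + d ^+ 2)) -
    front sigma ((d * rt n) ^+ 2) (c * A * (d * rt n)) n (z2^-1 * L n + x * rt n)| <= eta.
  by near: n; move/cvgrPdist_le : F; apply.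
have En : (K * e / d ^+ 2 + 61 * K / d ^+ 3 * (rt n)^-1) * (1 + (rt n)^-1 ^+ 2) +
   (2 * K / d * (rt n)^-1 + K * C / d ^+ 2 * (rt n)^-1 ^+ 2) <= eta.
  by apply: ltW; near: n; exact: (cvgr_lt _ E).
have := @barrier R sigma sigma_neq0 sigmaE K c (c * A * (d * rt n)) (d * rt n) eta
  _ _ e C HK cn (mulr_gt0 d0 r0) (ltW eta0) (ltW e0) C0 HC (lexx _) (lexx _) _ _ n _ n0 t0.
have bA : A * z2 ^+ 2 <= 2 * (d * rt n).
  by move: rA; rewrite ler_pdivrMr ?mulr_gt0//; lra.
move=> /(_ (fun t => front_boundary1 c1 A0 (mulr_gt0 d0 r0) bA (ltW eta0) HA1)).
move=> /(_ (fun m _ => front_boundary0 m c1 A0 (mulr_gt0 d0 r0) (ltW eta0) HA0)).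
move=> /le_trans; apply.
have hL : harm R n <= rt n ^+ 2 + 1 by rewrite r2 addrC harm_le_ln.
have k1h : (K * e / (d * rt n) ^+ 2 + 61 * K / (d * rt n) ^+ 3) * harm R n +
  (2 * K / (d * rt n) + K * C / (d * rt n) ^+ 2) <= eta.
  apply: le_trans En; rewrite [X in X + _ <= _](_ : _ =
    (K * e / d ^+ 2 + 61 * K / d ^+ 3 * (rt n)^-1) * (harm R n / rt n ^+ 2)); last first.
    by field; rewrite !gt_eqF.
  rewrite [X in _ + X <= _](_ : _ =
    2 * K / d * (rt n)^-1 + K * C / d ^+ 2 * (rt n)^-1 ^+ 2); last first.
    by field; rewrite !gt_eqF.
  rewrite lerD2r ler_wpM2l//.
    by rewrite addr_ge0 ?mulr_ge0 ?invr_ge0 ?exprn_ge0// ltW.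
  rewrite ler_pdivrMr ?exprn_gt0// mulrDl mul1r -exprMn mulVf ?gt_eqF// expr1n.
  exact: hL.
have cF : c * front sigma ((d * rt n) ^+ 2) (c * A * (d * rt n)) n (z2^-1 * L n + x * rt n) -
    c * Phi sigma x <= eta + eta.
  rewrite -mulrBr (le_trans (ler_norm _))// normrM cn mul1r.
  by rewrite (le_trans (ler_distD _ _ _) (lerD _ Hd))// distrC.
move: k1h cF; rewrite /eta; lra.
Unshelve. all: by end_near. Qed.

End Limit.

(* Convergence in distribution of (D_n - mu log n)/sqrt(log n) to
   Normal(0, sigma^2): the distribution functions converge at every x
   (every point is a continuity point of the normal distribution function). *)
Theorem theorem13p6 (R : realType) :
  let mu : R := (zeta R 2)^-1 in
  let sigma2 : R := 2 * zeta R 3 / (zeta R 2) ^+ 3 in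
  mu = 6 / pi ^+ 2 /\
  forall x : R,
    (fun n : nat =>
       (D_cdf n (mu * ln (n%:R) + x * Num.sqrt (ln (n%:R))))%:E)
      @ \oo --> normal_prob 0 (Num.sqrt sigma2) `]-oo, x].
Proof.
move=> mu sigma2; split; first by rewrite /mu zeta2E invf_div.
move=> x; set sigma := Num.sqrt sigma2.
have s2 : 0 < sigma2.
  rewrite divr_gt0 ?mulr_gt0 ?exprn_gt0 ?zeta2_gt0//.
  by rewrite (lt_le_trans ltr01)// zeta_ge1.
have s0 : sigma != 0 by rewrite gt_eqF// sqrtr_gt0.
have sE : sigma ^+ 2 = 2 * zeta R 3 / zeta R 2 ^+ 3 by rewrite sqr_sqrtr// ltW.
rewrite -PhiE; apply: cvg_EFin; first exact: nearW.
apply/cvgrPdist_le => eps eps0; near=> n.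
have up : 1 * D_cdf n (mu * ln (n%:R) + x * Num.sqrt (ln (n%:R))) <= 1 * Phi sigma x + eps.
  by near: n; apply: D_cdf_one_sided => //; left.
have lo : -1 * D_cdf n (mu * ln (n%:R) + x * Num.sqrt (ln (n%:R))) <= -1 * Phi sigma x + eps.
  by near: n; apply: D_cdf_one_sided => //; right.
rewrite !mul1r in up; rewrite !mulN1r in lo.
by rewrite /= ler_norml; apply/andP; split; lra.
Unshelve. all: by end_near. Qed.
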